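(* Let $b$ be a positive even integer and let $\mathcal K$ be a knot of braid index $b$ whose HOMFLY-PT polynomial is non-trivial, $H^{\mathcal K}(q,A)\neq 1$, and such that the $\mathfrak{sl}_n$ Reshetikhin--Turaev invariants of $\mathcal K$ are trivial for all $n\le \frac b2$, i.e. $H^{\mathcal K}(q,A=q^n)=1$ for every integer $1\le n\le \frac b2$. Then $$H^{\mathcal K}(q,A)=1+F(q,A)\cdot\prod_{\substack{k=-b/2\\ k\neq 0}}^{b/2}\left(A^2-q^{2k}\right),$$ where, for some non-negative integer $m$, $F$ is one of the two functions $$F=-\sum_{j=0}^{m}\frac{[2j+b]_q\,[\tfrac b2]_q\,[j+1,b-1]_q}{[b]_q!\,[j+\tfrac b2]_q}\,A^{-2j-2b}\qquad\text{or}\qquad F=-\sum_{j=0}^{m}\frac{[2j+b]_q\,[\tfrac b2]_q\,[j+1,b-1]_q}{[b]_q!\,[j+\tfrac b2]_q}\,A^{2j}.$$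
   Context: $[x]_q=\frac{q^x-q^{-x}}{q-q^{-1}}$; $[j]_q!=[j]_q[j-1]_q\cdots[1]_q$ is the $q$-factorial; $[j,k]_q=[j]_q[j+1]_q\cdots[j+k-1]_q$ is the rising $q$-factorial. The braid index of a knot is the least number of strands of a braid whose closure is that knot. The HOMFLY-PT polynomial $H(q,A)$ of oriented links is the invariant equal to $1$ on the unknot and satisfying the skein relation $A\,H(L_+)-A^{-1}H(L_-)=(q-q^{-1})H(L_0)$, where $L_+,L_-,L_0$ are diagrams identical except near one point, where they have respectively a positive crossing, a negative crossing, and the oriented smoothing. The (fundamental, unknot-normalised) $\mathfrak{sl}_n$ Reshetikhin--Turaev invariant of a knot is $H(q,A=q^n)$; for $n=2$ it is the Jones polynomial. *)

(* Defs.v *)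
From mathcomp Require Import all_boot all_order all_algebra.
From Stdlib Require Import Relations.
Set Implicit Arguments. Unset Strict Implicit. Unset Printing Implicit Defensive.
Import Order.TTheory GRing.Theory Num.Theory.
Local Open Scope ring_scope.

(** ** Oriented link diagrams

   A diagram in general position with respect to the height function is cut by
   horizontal lines into elementary pieces: local minima, local maxima and
   crossings.  It is recorded as the word of its pieces read upwards; [(x, i)]
   is the piece [x] placed with exactly [i] strands to its left.  A horizontal
   section is the list of the orientations of the strands it meets ([true] is
   upwards). *)

Inductive piece : Type :=
| Cup of bool   (* minimum; the flag orients its left leg *)
| Cap           (* maximum *)
| Cross of bool (* [true]: the strand from bottom left to top right is over *).

Definition slice : Type := (piece * nat)%type.
Definition word : Type := seq slice.
Definition section : Type := seq bool.

Definition win (x : piece) : nat := if x is Cup _ then 0%N else 2%N.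
Definition wout (x : piece) : nat := if x is Cap then 0%N else 2%N.

Definition local_step (x : piece) (s : section) : option section :=
  match x, s with
  | Cup o, _ => Some [:: o, ~~ o & s]
  | Cap, o :: o' :: s' => if o != o' then Some s' else None
  | Cross _, o :: o' :: s' => Some [:: o', o & s']
  | _, _ => None
  end.

Definition step (a : slice) (s : section) : option section :=
  if (a.2 <= size s)%N
  then omap (cat (take a.2 s)) (local_step a.1 (drop a.2 s)) else None.

Fixpoint run (w : word) (s : section) : option section :=
  if w is a :: w' then obind (run w') (step a s) else Some s.

Definition is_diagram (w : word) : bool := run w [::] == Some [::].

(** ** Isotopy

   The moves are the planar isotopies of diagrams in general position
   (exchanging the heights of distant pieces, straightening a zigzag, sliding a
   strand across an extremum) and the three Reidemeister moves. *)

Inductive move : word -> word -> Prop :=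
| move_exchange x y i d :
    move [:: (x, i); (y, i + wout x + d)%N] [:: (y, i + win x + d)%N; (x, i)]
| move_zigzag_r o i : move [:: (Cup o, i); (Cap, i.+1)] [::]
| move_zigzag_l o i : move [:: (Cup o, i.+1); (Cap, i)] [::]
| move_slide_cup o e i :
    move [:: (Cup o, i); (Cross e, i.+1)] [:: (Cup o, i.+1); (Cross (~~ e), i)]
| move_slide_cap e i :
    move [:: (Cross e, i.+1); (Cap, i)] [:: (Cross (~~ e), i); (Cap, i.+1)]
| move_R1_cup o e i : move [:: (Cup o, i); (Cross e, i)] [:: (Cup (~~ o), i)]
| move_R1_cap e i : move [:: (Cross e, i); (Cap, i)] [:: (Cap, i)]
| move_R2 e i : move [:: (Cross e, i); (Cross (~~ e), i)] [::]
  (* [e1], [e2], [e3] compare the heights of the first and second, first and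
     third, second and third strand; the two cyclic patterns are excluded *)
| move_R3 (e1 e2 e3 : bool) i of (e2 == e1) || (e2 == e3) :
    move [:: (Cross e1, i); (Cross e2, i.+1); (Cross e3, i)]
         [:: (Cross e3, i.+1); (Cross e2, i); (Cross e1, i.+1)].

Inductive link_step : word -> word -> Prop :=
| LinkStep u v a b of move a b & is_diagram (u ++ a ++ v)
    & is_diagram (u ++ b ++ v) : link_step (u ++ a ++ v) (u ++ b ++ v).

Definition isotopic : word -> word -> Prop := clos_refl_sym_trans word link_step.

(** ** Knots *)

(* [(k, p)] is the [p]-th strand met by the section above the first [k] pieces;
   [arc_step w] relates two such points joined by an arc inside a single slice. *)
Definition point : Type := (nat * nat)%type.

Definition is_point (w : word) (P : point) : Prop :=
  (P.1 <= size w)%N /\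
  (P.2 < size (odflt [::] (run (take P.1 w) [::])))%N.

Inductive arc_step (w : word) : point -> point -> Prop :=
| arc_left k x i p of onth w k = Some (x, i) & (p < i)%N :
    arc_step w (k, p) (k.+1, p)
| arc_right k x i d of onth w k = Some (x, i) :
    arc_step w (k, i + win x + d)%N (k.+1, i + wout x + d)%N
| arc_cup k o i of onth w k = Some (Cup o, i) :
    arc_step w (k.+1, i) (k.+1, i.+1)
| arc_cap k i of onth w k = Some (Cap, i) : arc_step w (k, i) (k, i.+1)
| arc_cross_r k e i of onth w k = Some (Cross e, i) :
    arc_step w (k, i) (k.+1, i.+1)
| arc_cross_l k e i of onth w k = Some (Cross e, i) :
    arc_step w (k, i.+1) (k.+1, i).

Definition is_knot (w : word) : Prop :=
  [/\ is_diagram w, w <> [::] &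
      forall P Q, is_point w P -> is_point w Q ->
        clos_refl_sym_trans point (arc_step w) P Q].

(** ** Closed braids and braid index *)

(* braid words on [n] strands in the generators and their inverses *)
Definition braid (n : nat) : Type := seq ('I_n.-1 * bool).

(* the braid runs upwards on the strands [0 .. n-1]; the strands [n .. 2n-1]
   return downwards on its right *)
Definition braid_closure (n : nat) (beta : braid n) : word :=
  [seq (Cup true, k) | k <- iota 0 n]
  ++ [seq (Cross g.2, nat_of_ord g.1) | g <- beta]
  ++ [seq (Cap, k) | k <- rev (iota 0 n)].

Definition braid_index (K : word) (b : nat) : Prop :=
  (exists beta : braid b, isotopic (braid_closure beta) K) /\
  (forall (n : nat) (beta : braid n),
     isotopic (braid_closure beta) K -> (b <= n)%N).

(** ** The field Q(q)(A) *)

Definition Qq : fieldType := {fraction {poly rat}}.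
Definition QqA : fieldType := {fraction {poly Qq}}.

Definition q : Qq := tofrac 'X.
Definition A : QqA := tofrac 'X.
Definition inA (c : Qq) : QqA := tofrac c%:P.

(* [f] is defined at [A = a] and takes there the value [v] *)
Definition has_value_at (f : QqA) (a v : Qq) : Prop :=
  exists p d : {poly Qq},
    [/\ d.[a] != 0, f = tofrac p / tofrac d & v = p.[a] / d.[a]].

(** ** The HOMFLY-PT polynomial *)

Definition unknot : word := [:: (Cup true, 0%N); (Cap, 0%N)].

(* Rotating one strand of a crossing by a half-turn reverses its sign: a
   crossing [Cross e] of strands entering from below with orientations [o]
   (left) and [o'] (right) is positive iff [e = (o == o')]. *)
Definition smoothing (o o' : bool) (i : nat) : word :=
  if o == o' then [::] else [:: (Cap, i); (Cup o', i)].

Record is_HOMFLYPT (H : word -> QqA) : Prop := IsHOMFLYPT {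
  HOMFLYPT_isotopy : forall D E, isotopic D E -> H D = H E;
  HOMFLYPT_unknot : H unknot = 1;
  HOMFLYPT_skein : forall (u v : word) (s1 s2 : section) (o o' : bool),
    let i := size s1 in
    let Lpos := u ++ (Cross (o == o'), i) :: v in
    let Lneg := u ++ (Cross (o != o'), i) :: v in
    let L0 := u ++ smoothing o o' i ++ v in
    run u [::] = Some (s1 ++ [:: o, o' & s2]) ->
    is_diagram Lpos ->
    A * H Lpos - A^-1 * H Lneg = inA (q - q^-1) * H L0 }.

(** ** q-numbers and the two families of functions *)

Definition qnum (x : nat) : Qq := (q ^+ x - q ^- x) / (q - q^-1).
Definition qfact (j : nat) : Qq := \prod_(1 <= i < j.+1) qnum i.
Definition qrise (j k : nat) : Qq := \prod_(i < k) qnum (j + i).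

Definition coefF (b j : nat) : Qq :=
  qnum (2 * j + b) * qnum b./2 * qrise j.+1 b.-1 / (qfact b * qnum (j + b./2)).

Definition F_neg (b m : nat) : QqA :=
  - \sum_(0 <= j < m.+1) inA (coefF b j) * A ^- (2 * j + 2 * b).

Definition F_pos (b m : nat) : QqA :=
  - \sum_(0 <= j < m.+1) inA (coefF b j) * A ^+ (2 * j).

(* the index is [k = i - b/2], so that [k = 0] is [i = b/2] *)
Definition prodA (b : nat) : QqA :=
  \prod_(i < b.+1 | i != b./2 :> nat)
    (A ^+ 2 - inA (q ^ (2 * (i%:Z - (b./2)%:Z)))).

(* Main.v *)
Require Import Defs.
From HB Require Import structures.
From mathcomp Require Import all_boot all_order all_algebra perm generic_quotient.
From mathcomp Require Import zify ring.
From Stdlib Require Import Relations.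
Import Order.TTheory GRing.Theory Num.Theory.
Set Implicit Arguments. Unset Strict Implicit. Unset Printing Implicit Defensive.

(** For a diagram of a closed braid on [n] strands, [A^writhe] times the
    HOMFLY-PT polynomial satisfies the Hecke relations, so every braid word
    reduces to words in which the last generator occurs at most once, and
    removing that generator by a Markov move yields the Morton--Franks--Williams
    bound: [H] is [A^(1-n-writhe)] times a polynomial of degree at most [n-1] in
    [A^2].  The same induction shows that its coefficients are symmetric or
    antisymmetric under [q -> q^-1], according to the parity of the writhe.  The
    number of 2-colourings of the components is an isotopy invariant; for a knot
    it forces the braid permutation to be an [n]-cycle, whence for even [n]
    the writhe is odd and the coefficients are symmetric.

    Thus [H = A^(2t) p(A^2)] with [deg p < b], and [H - 1] vanishes at
    [A^2 = q^(2k)] for [0 < |k| <= b/2], i.e. at [b] points.  If [-b < t <= 0]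
    this forces [H = 1].  If [t > 0], then [H - 1] is the product of the [A^2]-polynomial
    [P] with these roots and a polynomial of degree less than [t], which must be
    the truncation of the power series of [-1/P]; the case [t <= -b] is its mirror
    image under [A -> A^-1]. *)

Local Open Scope ring_scope.
Local Open Scope nat_scope.

(** * Isotopies of diagrams with boundary *)

Lemma run_cat u v s : run (u ++ v) s = obind (run v) (run u s).
Proof. by elim: u s => //= a u IH s; case: (step a s) => //=. Qed.

Lemma size_local_step x p r : size p = win x -> local_step x p = Some r ->
  size r = wout x.
Proof.
by case: x => [o||e]; case: p => [|o1 [|o2 [|? ?]]] //= _; [|case: ifP => // _|];
  move=> [<-].
Qed.

Lemma local_step_cat x p s : size p = win x ->
  local_step x (p ++ s) = omap (cat^~ s) (local_step x p).
Proof.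
by case: x => [o||e]; case: p => [|o1 [|o2 [|? ?]]] //= _; case: ifP.
Qed.

Lemma step_at x i s1 p r s2 : size s1 = i -> size p = win x ->
  local_step x p = Some r -> step (x, i) (s1 ++ p ++ s2) = Some (s1 ++ r ++ s2).
Proof.
move=> <- sp xp; rewrite /step /= size_cat leq_addr take_size_cat // drop_size_cat //.
by rewrite local_step_cat // xp.
Qed.

Lemma stepP x i s t : step (x, i) s = Some t ->
  exists s1 p r s2, [/\ s = s1 ++ p ++ s2, size s1 = i, size p = win x,
    local_step x p = Some r & t = s1 ++ r ++ s2].
Proof.
rewrite /step /=; case: leqP => // le_is.
have si : size (take i s) = i by rewrite size_takel.
move: (take i s) (drop i s) (cat_take_drop i s) si => s1 s' <- si {s le_is}.
case: x => [o||e] /=.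
- by move=> [<-]; exists s1, [::], [:: o; ~~ o], s'.
- case: s' => [|o [|o' s2]] //=; case: ifP => //= oo [<-].
  by exists s1, [:: o; o'], [::], s2; rewrite /= oo.
- case: s' => [|o [|o' s2]] //= [<-].
  by exists s1, [:: o; o'], [:: o'; o], s2.
Qed.

Definition shift k (w : word) : word := [seq (a.1, k + a.2) | a <- w].

(** Isotopy of tangles, tested by closing up: [isotopic] only sees closed diagrams, so the two words
    must be exchangeable between every [u] and [v] that complete them to one. *)
Definition tiso (s t : section) (a b : word) : Prop :=
  [/\ run a s = Some t, run b s = Some t &
      forall u v, run u [::] = Some s -> run v t = Some [::] ->
        isotopic (u ++ a ++ v) (u ++ b ++ v)].

(** Only the runs of the two whole words have to be computed; the section at which the move takes
    place never appears. *)
Lemma tiso_move_in s t c a b d : move a b ->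
  run (c ++ a ++ d) s = Some t -> run (c ++ b ++ d) s = Some t ->
  tiso s t (c ++ a ++ d) (c ++ b ++ d).
Proof.
move=> ab ra rb; split=> // u v ru rv; apply: rst_step.
have E x : u ++ (c ++ x ++ d) ++ v = (u ++ c) ++ x ++ (d ++ v) by rewrite -!catA.
rewrite !E; apply: LinkStep => //; rewrite -E;
by rewrite /is_diagram run_cat ru /= run_cat ?ra ?rb /= rv.
Qed.

Lemma tiso_move s t a b : move a b ->
  run a s = Some t -> run b s = Some t -> tiso s t a b.
Proof.
move=> ab ra rb; rewrite -[a]cats0 -[b]cats0.
by apply: (@tiso_move_in _ _ [::]) => //=; rewrite cats0.
Qed.

Lemma tiso_refl s t a : run a s = Some t -> tiso s t a a.
Proof. by move=> ra; split=> // u v _ _; apply: rst_refl. Qed.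

Lemma tiso_sym s t a b : tiso s t a b -> tiso s t b a.
Proof. by case=> ra rb ab; split=> // u v ru rv; apply/rst_sym/ab. Qed.

Lemma tiso_trans s t a b c : tiso s t a b -> tiso s t b c -> tiso s t a c.
Proof.
case=> ra rb ab [_ rc bc]; split=> // u v ru rv.
exact: rst_trans (ab _ _ ru rv) (bc _ _ ru rv).
Qed.

Lemma tiso_cat s t r a b c d : tiso s t a b -> tiso t r c d ->
  tiso s r (a ++ c) (b ++ d).
Proof.
case=> ra rb ab [rc rd cd]; split; rewrite ?run_cat ?ra ?rb //= => u v ru rv.
rewrite -!catA; apply: (@rst_trans _ _ _ (u ++ b ++ c ++ v)).
  by apply: ab => //; rewrite run_cat rc.
by rewrite !(catA u b); apply: cd => //; rewrite run_cat ru.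
Qed.

Lemma tiso_catl s t r a c d : run a s = Some t -> tiso t r c d ->
  tiso s r (a ++ c) (a ++ d).
Proof. by move=> ra; apply: tiso_cat; apply: tiso_refl. Qed.

Lemma tiso_catr s t r a b c : run c t = Some r -> tiso s t a b ->
  tiso s r (a ++ c) (b ++ c).
Proof. by move=> rc ab; apply: tiso_cat ab _; apply: tiso_refl. Qed.

Lemma tiso_closed a b : tiso [::] [::] a b -> isotopic a b.
Proof. by case=> _ _ /(_ [::] [::] erefl erefl); rewrite !cats0. Qed.

Lemma step_left a s1 t1 s2 : step a s1 = Some t1 -> step a (s1 ++ s2) = Some (t1 ++ s2).
Proof.
case: a => x i /stepP[l [p [r [m [-> sl sp xp ->]]]]]; rewrite -!catA.
exact: step_at.
Qed.

Lemma run_left w s1 t1 s2 : run w s1 = Some t1 -> run w (s1 ++ s2) = Some (t1 ++ s2).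
Proof.
elim: w s1 => [|a w IH] s1 /=; first by case=> ->.
by case E: (step a s1) => [t|] //= /IH; rewrite (step_left _ E).
Qed.

Lemma step_right y j s1 s2 t2 : step (y, j) s2 = Some t2 ->
  step (y, size s1 + j) (s1 ++ s2) = Some (s1 ++ t2).
Proof.
move/stepP=> [l [p [r [m [-> sl sp xp ->]]]]]; rewrite !(catA s1 l).
by apply: step_at => //; rewrite size_cat sl.
Qed.

Lemma tiso_exchange1 a y j s1 t1 s2 t2 : step a s1 = Some t1 ->
  step (y, j) s2 = Some t2 ->
  tiso (s1 ++ s2) (t1 ++ t2) [:: a; (y, size t1 + j)] [:: (y, size s1 + j); a].
Proof.
case: a => x i sa sy.
have ra : run [:: (x, i); (y, size t1 + j)] (s1 ++ s2) = Some (t1 ++ t2).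
  by rewrite /= (step_left _ sa) /= (step_right _ sy).
have rb : run [:: (y, size s1 + j); (x, i)] (s1 ++ s2) = Some (t1 ++ t2).
  by rewrite /= (step_right _ sy) /= (step_left _ sa).
apply: tiso_move => //.
have [l [p [r [m [-> sl sp xp ->]]]]] := stepP sa.
have sr := size_local_step sp xp.
(* The distance [d] of the exchange is [size m + j]: the strands to the right of the window of [x]
   and to the left of that of [y]. *)
have -> : size (l ++ r ++ m) + j = i + wout x + (size m + j) by rewrite !size_cat; lia.
have -> : size (l ++ p ++ m) + j = i + win x + (size m + j) by rewrite !size_cat; lia.
exact: move_exchange.
Qed.

(** This lets a crossing of the returning strands, or the innermost minimum, pass a whole braid
    word. *)
Lemma tiso_exchange w y j s1 t1 s2 t2 : run w s1 = Some t1 ->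
  step (y, j) s2 = Some t2 ->
  tiso (s1 ++ s2) (t1 ++ t2) (rcons w (y, size t1 + j)) ((y, size s1 + j) :: w).
Proof.
move=> rw sy; elim: w s1 rw => [|a w IH] s1 /=.
  by case=> ->; apply: tiso_refl; rewrite /= (step_right _ sy).
case E: (step a s1) => [t|] //= rw.
apply: (@tiso_trans _ _ _ ([:: a] ++ (y, size t + j) :: w)).
  by apply: (@tiso_catl _ (t ++ s2) _ [:: a] _ ((y, size t + j) :: w));
    rewrite /= ?(step_left _ E) //; exact: IH.
apply: (@tiso_catr _ (t ++ t2) _ [:: a; (y, size t + j)] [:: (y, size s1 + j); a] w).
  exact: run_left.
exact: tiso_exchange1.
Qed.

Lemma run_shift w s1 s2 t2 : run w s2 = Some t2 ->
  run (shift (size s1) w) (s1 ++ s2) = Some (s1 ++ t2).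
Proof.
elim: w s2 => [|[x i] w IH] s2 /=; first by case=> ->.
by case E: (step (x, i) s2) => [t|] //= /IH; rewrite (step_right _ E).
Qed.

(** * Closed braids *)

(** Positions are plain numbers constrained by [on_strands], so that one word can be closed on
    different numbers of strands. *)
Definition crossings (w : seq (nat * bool)) : word := [seq (Cross g.2, g.1) | g <- w].
Definition cups n : word := [seq (Cup true, k) | k <- iota 0 n].
Definition caps n : word := [seq (Cap, k) | k <- rev (iota 0 n)].
Definition braid_diagram n w : word := cups n ++ crossings w ++ caps n.

Definition on_strands n (w : seq (nat * bool)) : bool := all (fun g => g.1.+1 < n) w.

Lemma cupsS n : cups n.+1 = rcons (cups n) (Cup true, n).
Proof. by rewrite /cups -addn1 iotaD map_cat cats1. Qed.

Lemma capsS n : caps n.+1 = (Cap, n) :: caps n.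
Proof. by rewrite /caps -addn1 iotaD rev_cat map_cat. Qed.

Lemma crossings_cat u v : crossings (u ++ v) = crossings u ++ crossings v.
Proof. exact: map_cat. Qed.

Lemma on_strands_cat n u v : on_strands n (u ++ v) = on_strands n u && on_strands n v.
Proof. exact: all_cat. Qed.

Lemma on_strandsS n w : on_strands n w -> on_strands n.+1 w.
Proof. by apply: sub_all => g; apply: ltnW. Qed.

Lemma run1 a s : run [:: a] s = step a s.
Proof. by rewrite /=; case: step. Qed.

Lemma step_cup o i s1 s2 : size s1 = i ->
  step (Cup o, i) (s1 ++ s2) = Some (s1 ++ [:: o, ~~ o & s2]).
Proof. by move=> si; apply: (@step_at (Cup o) i s1 [::] [:: o; ~~ o] s2). Qed.

Lemma step_cap o i s1 s2 : size s1 = i ->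
  step (Cap, i) (s1 ++ [:: o, ~~ o & s2]) = Some (s1 ++ s2).
Proof. by move=> si; apply: (@step_at Cap i s1 [:: o; ~~ o] [::] s2); case: o. Qed.

Lemma step_cross e i s1 o o' s2 : size s1 = i ->
  step (Cross e, i) (s1 ++ [:: o, o' & s2]) = Some (s1 ++ [:: o', o & s2]).
Proof. by move=> si; apply: (@step_at (Cross e) i s1 [:: o; o'] [:: o'; o] s2). Qed.

Lemma step_cross_nseq e i n o : i.+1 < n ->
  step (Cross e, i) (nseq n o) = Some (nseq n o).
Proof.
move=> lt_in; have -> : n = i + (n - i.+2).+2 by lia.
by rewrite nseqD; apply: step_cross; rewrite size_nseq.
Qed.

Lemma run_crossings n w o : on_strands n w -> run (crossings w) (nseq n o) = Some (nseq n
  o).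
Proof. by elim: w => //= g w IH /andP[gn wn]; rewrite step_cross_nseq //= IH. Qed.

Definition braid_section n : section := nseq n true ++ nseq n false.

Lemma braid_sectionS n :
  braid_section n.+1 = nseq n true ++ [:: true, false & nseq n false].
Proof. by rewrite /braid_section -{1}addn1 nseqD -catA. Qed.

Lemma step_cup_braid n :
  step (Cup true, n) (braid_section n) = Some (braid_section n.+1).
Proof. by rewrite braid_sectionS step_cup // size_nseq. Qed.

Lemma step_cap_braid n :
  step (Cap, n) (braid_section n.+1) = Some (braid_section n).
Proof. by rewrite braid_sectionS (step_cap true) // size_nseq. Qed.

Lemma run_cups n : run (cups n) [::] = Some (braid_section n).
Proof. by elim: n => // n IH; rewrite cupsS -cats1 run_cat IH /= step_cup_braid. Qed.

Lemma run_caps n : run (caps n) (braid_section n) = Some [::].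
Proof. by elim: n => // n IH; rewrite capsS /= step_cap_braid /= IH. Qed.

Lemma run_crossings_braid n w : on_strands n w ->
  run (crossings w) (braid_section n) = Some (braid_section n).
Proof. by move=> wn; apply/run_left/run_crossings. Qed.

Lemma is_diagram_closure n w : on_strands n w -> is_diagram (braid_diagram n w).
Proof.
move=> wn; rewrite /is_diagram /braid_diagram run_cat run_cups /= run_cat.
by rewrite run_crossings_braid //= run_caps.
Qed.

Lemma closure_tiso n x y : on_strands n x ->
  tiso (braid_section n) (braid_section n) (crossings x) (crossings y) ->
  isotopic (braid_diagram n x) (braid_diagram n y).
Proof. by move=> xn [_ _]; apply; rewrite ?run_cups ?run_caps. Qed.

Lemma closure_move n u a b v : on_strands n u -> on_strands n v ->
  on_strands n a -> on_strands n b -> move (crossings a) (crossings b) ->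
  isotopic (braid_diagram n (u ++ a ++ v)) (braid_diagram n (u ++ b ++ v)).
Proof.
move=> un vn an bn ab; apply: closure_tiso.
  by rewrite !on_strands_cat un vn an.
rewrite !crossings_cat; apply: tiso_catl (run_crossings_braid un) _.
apply: tiso_catr (run_crossings_braid vn) _.
by apply: tiso_move ab _ _; rewrite run_crossings_braid.
Qed.

Lemma closure_R2 n u v i e : on_strands n u -> on_strands n v -> i.+1 < n ->
  isotopic (braid_diagram n (u ++ [:: (i, e); (i, ~~ e)] ++ v)) (braid_diagram n (u ++ v)).
Proof.
move=> un vn lt_in; apply: (@closure_move n u [:: (i, e); (i, ~~ e)] [::]) => //=.
  by rewrite lt_in.
exact: move_R2.
Qed.

Lemma closure_R3 n u v i e : on_strands n u -> on_strands n v -> i.+2 < n ->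
  isotopic (braid_diagram n (u ++ [:: (i, e); (i.+1, e); (i, e)] ++ v))
           (braid_diagram n (u ++ [:: (i.+1, e); (i, e); (i.+1, e)] ++ v)).
Proof.
move=> un vn lt_in; apply: closure_move => //=; try by rewrite lt_in (ltnW lt_in).
by apply: move_R3; rewrite eqxx.
Qed.

Lemma closure_comm n u v i j e f : on_strands n u -> on_strands n v ->
    i.+1 < j -> j.+1 < n ->
  isotopic (braid_diagram n (u ++ [:: (i, e); (j, f)] ++ v))
           (braid_diagram n (u ++ [:: (j, f); (i, e)] ++ v)).
Proof.
move=> un vn lt_ij lt_jn; have lt_in : i.+1 < n by lia.
apply: closure_move => //=; try by rewrite lt_in lt_jn.
by have := move_exchange (Cross e) (Cross f) i (j - i.+2);
  have -> : i + 2 + (j - i.+2) = j by lia.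
Qed.

(* The crossing slides over the innermost maxima one leg at a time. *)
Lemma tiso_cross_caps n e i : i.+1 < n ->
  tiso (braid_section n) [::] ((Cross e, i) :: caps n)
       ((Cross e, n + (n - i.+2)) :: caps n).
Proof.
elim: n => // n IH; rewrite ltnS leq_eqVlt => /orP[/eqP <-{n IH}|lt_in].
  (* Here the crossed strands end in the two innermost maxima. The crossing slides over a leg of
     one, the two maxima exchange heights, and it slides over a leg of the other; each slide flips
     the flag, so [e] is restored. [R0] to [R3] are the runs of the four stages. *)
  set s := nseq i true; set r := nseq i false.
  have bs : braid_section i.+2 = s ++ [:: true; true; false; false] ++ r.
    by rewrite braid_sectionS -{1}addn1 nseqD -catA.
  have ss : size s = i by rewrite size_nseq.
  have s1 x : size (s ++ [:: x]) = i.+1 by rewrite size_cat ss addn1.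
  have s2 x y : size (s ++ [:: x; y]) = i.+2 by rewrite size_cat ss addn2.
  rewrite subnn addn0 !capsS bs.
  apply: (@tiso_catr _ (s ++ r) _ [:: (Cross e, i); (Cap, i.+1); (Cap, i)]
     [:: (Cross e, i.+2); (Cap, i.+1); (Cap, i)] (caps i)); first exact: run_caps.
  have rs w : run w ([:: true; true; false; false] ++ r) = Some r ->
      run (shift i w) (s ++ [:: true; true; false; false] ++ r) = Some (s ++ r).
    by move/(run_shift s); rewrite size_nseq.
  have R0 x : run [:: (Cross x, i); (Cap, i.+1); (Cap, i)]
      (s ++ [:: true; true; false; false] ++ r) = Some (s ++ r).
    by have := rs [:: (Cross x, 0); (Cap, 1); (Cap, 0)];
      rewrite /= addn0 addn1 ?take0 ?drop0; apply; rewrite /step /= ?take0 ?drop0.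
  have R1 x : run [:: (Cross x, i.+1); (Cap, i); (Cap, i)]
      (s ++ [:: true; true; false; false] ++ r) = Some (s ++ r).
    by have := rs [:: (Cross x, 1); (Cap, 0); (Cap, 0)];
      rewrite /= addn0 addn1 ?take0 ?drop0; apply; rewrite /step /= ?take0 ?drop0.
  have R2 x : run [:: (Cross x, i.+1); (Cap, i.+2); (Cap, i)]
      (s ++ [:: true; true; false; false] ++ r) = Some (s ++ r).
    by have := rs [:: (Cross x, 1); (Cap, 2); (Cap, 0)];
      rewrite /= addn0 addn1 addn2 ?take0 ?drop0; apply; rewrite /step /= ?take0 ?drop0.
  have R3 x : run [:: (Cross x, i.+2); (Cap, i.+1); (Cap, i)]
      (s ++ [:: true; true; false; false] ++ r) = Some (s ++ r).
    by have := rs [:: (Cross x, 2); (Cap, 1); (Cap, 0)];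
      rewrite /= addn0 addn1 addn2 ?take0 ?drop0; apply; rewrite /step /= ?take0 ?drop0.
  apply: (@tiso_trans _ _ _ [:: (Cross (~~ e), i.+1); (Cap, i); (Cap, i)]).
    apply/tiso_sym/(@tiso_move_in _ _ [::] [:: (Cross (~~ e), i.+1); (Cap, i)]
      [:: (Cross e, i); (Cap, i.+1)] [:: (Cap, i)]); [|exact: R1|exact: R0].
    by rewrite -{2}[e]negbK; apply: move_slide_cap.
  apply: (@tiso_trans _ _ _ [:: (Cross (~~ e), i.+1); (Cap, i.+2); (Cap, i)]).
    apply: (@tiso_move_in _ _ [:: (Cross (~~ e), i.+1)] [:: (Cap, i); (Cap, i)]
      [:: (Cap, i.+2); (Cap, i)] [::]); [|exact: R1|exact: R2].
    by have := move_exchange Cap Cap i 0; rewrite !addn0 addn2.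
  apply/tiso_sym/(@tiso_move_in _ _ [::] [:: (Cross e, i.+2); (Cap, i.+1)]
    [:: (Cross (~~ e), i.+1); (Cap, i.+2)] [:: (Cap, i)]); [|exact: R3|exact: R2].
  exact: move_slide_cap.
(* Otherwise the innermost maximum is pulled below the crossing, the induction hypothesis moves the
   crossing to the right, and the maximum is pushed back above it; two more strands then lie to the
   left of the crossing. *)
have lt_iSn := ltnW lt_in.
have Xl : step (Cross e, i) (nseq n true) = Some (nseq n true) by exact: step_cross_nseq.
have Xr j : j.+1 < n -> step (Cross e, j) (nseq n false) = Some (nseq n false).
  exact: step_cross_nseq.
have Cp : step (Cap, 0) ([:: true; false] ++ nseq n false) = Some (nseq n false).
  exact: (@step_cap true 0 [::]).
rewrite capsS; set j := n - i.+2; have lt_jn : j.+1 < n by rewrite /j; lia.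
have -> : n.+1 + (n.+1 - i.+2) = n.+2 + j by rewrite /j; lia.
rewrite braid_sectionS.
apply: (@tiso_trans _ _ _ ([:: (Cap, n); (Cross e, i)] ++ caps n)).
  apply: (@tiso_catr _ (braid_section n) _ [:: (Cross e, i); (Cap, n)] _ (caps n)).
    exact: run_caps.
  by have := tiso_exchange1 Xl Cp; rewrite size_nseq addn0.
apply: (@tiso_trans _ _ _ ([:: (Cap, n); (Cross e, n + j)] ++ caps n)).
  apply: (@tiso_catl _ (braid_section n) _ [:: (Cap, n)]).
    by rewrite run1 (step_cap true) // size_nseq.
  exact: IH.
apply: (@tiso_catr _ (braid_section n) _ [:: (Cap, n); (Cross e, n + j)]
   [:: (Cross e, n.+2 + j); (Cap, n)] (caps n)); first exact: run_caps.
have Cl : step (Cap, n) (nseq n true ++ [:: true; false]) = Some (nseq n true).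
  by rewrite (@step_cap true n _ [::]) ?size_nseq // cats0.
have := tiso_exchange1 Cl (Xr _ lt_jn).
by rewrite size_nseq size_cat size_nseq addn2 -catA.
Qed.

(** Upward strand [k] is joined to returning strand [2n - 1 - k], hence the position [2n - 2 - i].
    The slides are those over the maxima, turned upside down. *)
Lemma tiso_cross_cups n e i : i.+1 < n ->
  tiso [::] (braid_section n) (cups n ++ [:: (Cross e, i)])
       (cups n ++ [:: (Cross e, n + (n - i.+2))]).
Proof.
elim: n => // n IH; rewrite ltnS leq_eqVlt => /orP[/eqP <-{n IH}|lt_in].
  set s := nseq i true; set r := nseq i false.
  have bs : braid_section i.+2 = s ++ [:: true; true; false; false] ++ r.
    by rewrite braid_sectionS -{1}addn1 nseqD -catA.
  rewrite subnn addn0 !cupsS -!cats1 -!catA bs.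
  apply: (@tiso_catl _ (s ++ r) _ (cups i)); first exact: run_cups.
  have rs w : run w r = Some ([:: true; true; false; false] ++ r) ->
      run (shift i w) (s ++ r) = Some (s ++ [:: true; true; false; false] ++ r).
    by move/(run_shift s); rewrite size_nseq.
  have R0 x : run [:: (Cup true, i); (Cup true, i.+1); (Cross x, i)]
      (s ++ r) = Some (s ++ [:: true; true; false; false] ++ r).
    by have := rs [:: (Cup true, 0); (Cup true, 1); (Cross x, 0)];
      rewrite /= addn0 addn1 ?take0 ?drop0; apply; rewrite /step /= ?take0 ?drop0.
  have R1 x : run [:: (Cup true, i); (Cup true, i); (Cross x, i.+1)]
      (s ++ r) = Some (s ++ [:: true; true; false; false] ++ r).
    by have := rs [:: (Cup true, 0); (Cup true, 0); (Cross x, 1)];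
      rewrite /= addn0 addn1 ?take0 ?drop0; apply; rewrite /step /= ?take0 ?drop0.
  have R2 x : run [:: (Cup true, i); (Cup true, i.+2); (Cross x, i.+1)]
      (s ++ r) = Some (s ++ [:: true; true; false; false] ++ r).
    by have := rs [:: (Cup true, 0); (Cup true, 2); (Cross x, 1)];
      rewrite /= addn0 addn1 addn2 ?take0 ?drop0; apply; rewrite /step /= ?take0 ?drop0.
  have R3 x : run [:: (Cup true, i); (Cup true, i.+1); (Cross x, i.+2)]
      (s ++ r) = Some (s ++ [:: true; true; false; false] ++ r).
    by have := rs [:: (Cup true, 0); (Cup true, 1); (Cross x, 2)];
      rewrite /= addn0 addn1 addn2 ?take0 ?drop0; apply; rewrite /step /= ?take0 ?drop0.
  apply: (@tiso_trans _ _ _ [:: (Cup true, i); (Cup true, i); (Cross (~~ e), i.+1)]).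
    apply/tiso_sym/(@tiso_move_in _ _ [:: (Cup true, i)]
      [:: (Cup true, i); (Cross (~~ e), i.+1)]
      [:: (Cup true, i.+1); (Cross e, i)] [::]); [|exact: R1|exact: R0].
    by rewrite -{2}[e]negbK; apply: move_slide_cup.
  apply: (@tiso_trans _ _ _ [:: (Cup true, i); (Cup true, i.+2); (Cross (~~ e), i.+1)]).
    apply/tiso_sym/(@tiso_move_in _ _ [::] [:: (Cup true, i); (Cup true, i.+2)]
      [:: (Cup true, i); (Cup true, i)] [:: (Cross (~~ e), i.+1)]);
      [|exact: R2|exact: R1].
    by have := move_exchange (Cup true) (Cup true) i 0; rewrite !addn0 addn2.
  apply/tiso_sym/(@tiso_move_in _ _ [:: (Cup true, i)]
    [:: (Cup true, i.+1); (Cross e, i.+2)]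
    [:: (Cup true, i.+2); (Cross (~~ e), i.+1)] [::]); [|exact: R3|exact: R2].
  exact: move_slide_cup.
have lt_iSn := ltnW lt_in.
have Xl : step (Cross e, i) (nseq n true) = Some (nseq n true) by exact: step_cross_nseq.
have Xr j : j.+1 < n -> step (Cross e, j) (nseq n false) = Some (nseq n false).
  exact: step_cross_nseq.
have Cp : step (Cup true, 0) (nseq n false) = Some ([:: true; false] ++ nseq n false).
  exact: (@step_cup true 0 [::]).
rewrite cupsS -!cats1 -!catA; set j := n - i.+2.
have lt_jn : j.+1 < n by rewrite /j; lia.
have -> : n.+1 + (n.+1 - i.+2) = n.+2 + j by rewrite /j; lia.
rewrite braid_sectionS.
apply: (@tiso_trans _ _ _ (cups n ++ [:: (Cross e, i); (Cup true, n)])).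
  apply: (@tiso_catl _ (braid_section n) _ (cups n)); first exact: run_cups.
  by apply: tiso_sym; have := tiso_exchange1 Xl Cp; rewrite size_nseq addn0.
apply: (@tiso_trans _ _ _ (cups n ++ [:: (Cross e, n + j); (Cup true, n)])).
  have C a b : cups n ++ [:: a; b] = (cups n ++ [:: a]) ++ [:: b] by rewrite -catA.
  rewrite !C.
  apply: (@tiso_catr _ (braid_section n)); last exact: IH.
  by rewrite run1 step_cup // size_nseq.
apply: (@tiso_catl _ (braid_section n) _ (cups n)); first exact: run_cups.
have Cl : step (Cup true, n) (nseq n true) = Some (nseq n true ++ [:: true; false]).
  by rewrite -{1}[nseq n true]cats0 step_cup ?size_nseq.
apply: tiso_sym; have := tiso_exchange1 Cl (Xr _ lt_jn).
by rewrite size_nseq size_cat size_nseq addn2 -catA.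
Qed.

(** The last crossing travels around the closure: over the maxima to the returning strands, down
    past the braid, and under the minima to the bottom. *)
Lemma closure_conj1 n w i e : on_strands n w -> i.+1 < n ->
  isotopic (braid_diagram n (rcons w (i, e))) (braid_diagram n ((i, e) :: w)).
Proof.
move=> wn lt_in; set j := n - i.+2; have lt_jn : j.+1 < n by rewrite /j; lia.
apply: tiso_closed; rewrite /braid_diagram -cats1 crossings_cat -catA /=.
have rw := run_crossings_braid wn.
apply: (@tiso_trans _ _ _ (cups n ++ crossings w ++ [:: (Cross e, n + j)] ++ caps n)).
  apply: (@tiso_catl _ (braid_section n)); first exact: run_cups.
  by apply: (@tiso_catl _ (braid_section n)) => //; apply: tiso_cross_caps.
apply: (@tiso_trans _ _ _ (cups n ++ [:: (Cross e, n + j)] ++ crossings w ++ caps n)).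
  apply: (@tiso_catl _ (braid_section n)); first exact: run_cups.
  rewrite !catA; apply: (@tiso_catr _ (braid_section n)); first exact: run_caps.
  have Xr : step (Cross e, j) (nseq n false) = Some (nseq n false).
    exact: step_cross_nseq.
  by have := tiso_exchange (run_crossings true wn) Xr; rewrite size_nseq cats1.
suff: tiso [::] [::] ((cups n ++ [:: (Cross e, n + j)]) ++ crossings w ++ caps n)
    ((cups n ++ [:: (Cross e, i)]) ++ crossings w ++ caps n) by rewrite -!catA.
apply: (@tiso_catr _ (braid_section n)).
  by rewrite run_cat rw /= run_caps.
exact/tiso_sym/tiso_cross_cups.
Qed.

Lemma closure_conj n u v : on_strands n u -> on_strands n v ->
  isotopic (braid_diagram n (u ++ v)) (braid_diagram n (v ++ u)).
Proof.
elim/last_ind: v u => [|v [i e] IH] u un; first by rewrite cats0 => _; apply: rst_refl.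
rewrite -cats1 on_strands_cat => /andP[vn /= gn].
rewrite catA cats1; apply: (@rst_trans _ _ _ (braid_diagram n ((i, e) :: u ++ v))).
  by apply: closure_conj1; [rewrite on_strands_cat un|case/andP: gn].
by rewrite -catA; apply: (IH ((i, e) :: u)); rewrite //= un; case/andP: gn => ->.
Qed.

(** Markov stabilisation. As [w] leaves the last strand alone, the innermost minimum can rise to the
    new crossing. A slide turns the crossing into a kink of this minimum, which the first
    Reidemeister move removes; a zigzag is left. *)
Lemma closure_stab n w e : on_strands n.+1 w ->
  isotopic (braid_diagram n.+2 (rcons w (n, e))) (braid_diagram n.+1 w).
Proof.
move=> wn; apply: tiso_closed.
rewrite /braid_diagram cupsS capsS -!cats1 crossings_cat -!catA.
apply: (@tiso_catl _ (braid_section n.+1)); first exact: run_cups.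
have -> : [:: (Cup true, n.+1)] ++ crossings w ++ crossings [:: (n, e)] ++ (Cap, n.+1) ::
  caps n.+1
  = ([:: (Cup true, n.+1)] ++ crossings w ++ [:: (Cross e, n); (Cap, n.+1)]) ++ caps n.+1.
  by rewrite -!catA.
apply: (@tiso_catr _ (braid_section n.+1)); first exact: run_caps.
set s := nseq n true; set r := nseq n false.
have bs : braid_section n.+1 = s ++ [:: true; false] ++ r by exact: braid_sectionS.
have rs v : run v ([:: true; false] ++ r) = Some ([:: true; false] ++ r) ->
    run (shift n v) (braid_section n.+1) = Some (braid_section n.+1).
  by move/(run_shift s); rewrite size_nseq bs.
have R0 : run [:: (Cup true, n.+1); (Cross e, n); (Cap, n.+1)]
    (braid_section n.+1) = Some (braid_section n.+1).
  by have := rs [:: (Cup true, 1); (Cross e, 0); (Cap, 1)];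
    rewrite /= addn0 addn1 ?take0 ?drop0; apply; rewrite /step /= ?take0 ?drop0.
have R1 : run [:: (Cup true, n.+1); (Cross (~~ e), n.+1); (Cap, n)]
    (braid_section n.+1) = Some (braid_section n.+1).
  by have := rs [:: (Cup true, 1); (Cross (~~ e), 1); (Cap, 0)];
    rewrite /= addn0 addn1 ?take0 ?drop0; apply; rewrite /step /= ?take0 ?drop0.
have R2 : run [:: (Cup false, n.+1); (Cap, n)]
    (braid_section n.+1) = Some (braid_section n.+1).
  by have := rs [:: (Cup false, 1); (Cap, 0)];
    rewrite /= addn0 addn1 ?take0 ?drop0; apply; rewrite /step /= ?take0 ?drop0.
have rw := run_crossings_braid wn.
apply: (@tiso_trans _ _ _ (crossings w ++ [:: (Cup true, n.+1); (Cross e, n);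
  (Cap, n.+1)])).
  suff: tiso (braid_section n.+1) (braid_section n.+1)
      (((Cup true, n.+1) :: crossings w) ++ [:: (Cross e, n); (Cap, n.+1)])
      ((crossings w ++ [:: (Cup true, n.+1)]) ++ [:: (Cross e, n); (Cap, n.+1)]).
    by rewrite -!catA.
  have Cp : step (Cup true, 0) (nseq n.+1 false) = Some ([:: true;
    false] ++ nseq n.+1 false).
    exact: (@step_cup true 0 [::]).
  have := tiso_exchange (run_crossings true wn) Cp; rewrite !size_nseq addn0 -cats1.
  move/tiso_sym/(fun h => tiso_catr _ h); apply.
  rewrite -braid_sectionS.
  by move: R0; rewrite /= step_cup_braid.
rewrite -{2}[crossings w]cats0; apply: tiso_catl rw _.
apply: (@tiso_trans _ _ _ [:: (Cup true, n.+1); (Cross (~~ e), n.+1); (Cap, n)]).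
  apply/tiso_sym/(@tiso_move_in _ _ [:: (Cup true, n.+1)]
    [:: (Cross (~~ e), n.+1); (Cap, n)] [:: (Cross e, n); (Cap, n.+1)] [::]);
    [|exact: R1|exact: R0].
  by rewrite -{2}[e]negbK; apply: move_slide_cap.
apply: (@tiso_trans _ _ _ [:: (Cup false, n.+1); (Cap, n)]).
  apply: (@tiso_move_in _ _ [::] [:: (Cup true, n.+1); (Cross (~~ e), n.+1)]
    [:: (Cup false, n.+1)] [:: (Cap, n)]); [|exact: R1|exact: R2].
  exact: move_R1_cup.
by apply: tiso_move R2 _; [apply: move_zigzag_l|].
Qed.

(** * Parity of the number of crossings *)

(** Colours are constant along arcs: a minimum is a choice, a maximum is a test, and the orientation
    and over-under flags are ignored. *)
Definition outcomes (x : piece) (p : seq bool) : seq (seq bool) :=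
  match x, p with
  | Cup _, [::] => [:: [:: true; true]; [:: false; false]]
  | Cap, [:: c; c'] => if c == c' then [:: [::]] else [::]
  | Cross _, [:: c; c'] => [:: [:: c'; c]]
  | _, _ => [::]
  end.

Definition window (x : piece) i (s : seq bool) := take (win x) (drop i s).
Definition replace_window (x : piece) i (s o : seq bool) := take i s ++ o ++ drop (i +
  win x) s.

(* The number of 2-colourings of the components of the diagram [w] that extend
   the colouring [s] of its lowest section. *)
Fixpoint colorings (w : word) (s : seq bool) : nat :=
  if w is (x, i) :: w' then
    \sum_(o <- outcomes x (window x i s)) colorings w' (replace_window x i s o)
  else s == [::].

Lemma size_outcomes x p o : o \in outcomes x p -> size o = wout x.
Proof.
case: x => [o'||e]; case: p => [|c [|c' [|? ?]]] //=; last by rewrite inE => /eqP->.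
- by rewrite !inE => /orP[]/eqP->.
- by case: ifP => // _; rewrite inE => /eqP->.
Qed.

Lemma colorings_at x i w s1 p s2 : size s1 = i -> size p = win x ->
  colorings ((x, i) :: w) (s1 ++ p ++ s2) =
  \sum_(o <- outcomes x p) colorings w (s1 ++ o ++ s2).
Proof.
move=> si sp; rewrite /= /window /replace_window -si drop_size_cat // -sp take_size_cat //.
by rewrite take_size_cat // -size_cat catA drop_size_cat.
Qed.

Lemma colorings_cons x i w s : colorings ((x, i) :: w) s =
  \sum_(o <- outcomes x (window x i s)) colorings w (replace_window x i s o).
Proof. by []. Qed.

Arguments colorings : simpl never.

Lemma step_size x i s t : step (x, i) s = Some t ->
  i + win x <= size s /\ size t + win x = size s + wout x.
Proof.
move=> /stepP[s1 [p [r [s2 [-> <- sp xp ->]]]]].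
by rewrite !size_cat sp (size_local_step sp xp); split; lia.
Qed.

Lemma split_at i k (s : seq bool) : i + k <= size s ->
  exists s1 p s2, [/\ s = s1 ++ p ++ s2, size s1 = i & size p = k].
Proof.
move=> le_s; exists (take i s), (take k (drop i s)), (drop k (drop i s)).
by rewrite !cat_take_drop !size_takel ?size_drop //; lia.
Qed.

Lemma split_at1 i (s : seq bool) : i < size s ->
  exists s1 a s2, s = s1 ++ a :: s2 /\ size s1 = i.
Proof.
rewrite -addn1 => /split_at[s1 [[|a [|? ?]] [s2 [-> <-]]]] //.
by exists s1, a, s2.
Qed.

Lemma split_at2 i (s : seq bool) : i.+1 < size s ->
  exists s1 a b s2, s = s1 ++ [:: a, b & s2] /\ size s1 = i.
Proof.
rewrite -addn2 => /split_at[s1 [[|a [|b [|? ?]]] [s2 [-> <-]]]] //.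
by exists s1, a, b, s2.
Qed.

Lemma split_at3 i (s : seq bool) : i.+2 < size s ->
  exists s1 a b c s2, s = s1 ++ [:: a, b, c & s2] /\ size s1 = i.
Proof.
rewrite -addn3 => /split_at[s1 [[|a [|b [|c [|? ?]]]] [s2 [-> <-]]]] //.
by exists s1, a, b, c, s2.
Qed.

Lemma colorings_cup o i w s1 s2 : size s1 = i ->
  colorings ((Cup o, i) :: w) (s1 ++ s2) =
  colorings w (s1 ++ [:: true, true & s2]) + colorings w (s1 ++ [:: false, false & s2]).
Proof.
by move=> si; rewrite (@colorings_at (Cup o) i w s1 [::]) //= !big_cons big_nil addn0.
Qed.

Lemma colorings_cap i w s1 c c' s2 : size s1 = i ->
  colorings ((Cap, i) :: w) (s1 ++ [:: c, c' & s2]) =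
  if c == c' then colorings w (s1 ++ s2) else 0.
Proof.
move=> si; rewrite (@colorings_at Cap i w s1 [:: c; c']) //=.
by case: ifP => _; rewrite ?big_cons big_nil ?addn0.
Qed.

Lemma colorings_cross e i w s1 c c' s2 : size s1 = i ->
  colorings ((Cross e, i) :: w) (s1 ++ [:: c, c' & s2]) =
  colorings w (s1 ++ [:: c', c & s2]).
Proof.
by move=> si; rewrite (@colorings_at (Cross e) i w s1 [:: c;
  c']) //= big_cons big_nil addn0.
Qed.

Lemma colorings_cupS o i w s1 a s2 : size s1 = i ->
  colorings ((Cup o, i.+1) :: w) (s1 ++ a :: s2) =
  colorings w (s1 ++ [:: a, true, true & s2]) + colorings w (s1 ++ [:: a, false, false &
    s2]).
Proof. by move=> si; rewrite -cat_rcons colorings_cup ?size_rcons ?si // !cat_rcons. Qed.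

Lemma colorings_capS i w s1 a c c' s2 : size s1 = i ->
  colorings ((Cap, i.+1) :: w) (s1 ++ [:: a, c, c' & s2]) =
  if c == c' then colorings w (s1 ++ a :: s2) else 0.
Proof. by move=> si; rewrite -cat_rcons colorings_cap ?size_rcons ?si // !cat_rcons. Qed.

Lemma colorings_crossS e i w s1 a c c' s2 : size s1 = i ->
  colorings ((Cross e, i.+1) :: w) (s1 ++ [:: a, c, c' & s2]) =
  colorings w (s1 ++ [:: a, c', c & s2]).
Proof. by move=> si; rewrite -cat_rcons colorings_cross ?size_rcons ?si // !cat_rcons. Qed.

Definition coloringsE :=
  (colorings_cupS, colorings_capS, colorings_crossS,
   colorings_cup, colorings_cap, colorings_cross).

Lemma run2 x y s t : run [:: x; y] s = Some t ->
  exists2 r, step x s = Some r & step y r = Some t.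
Proof. by rewrite /=; case: (step x s) => //= r; case E: (step y r) => //= -[<-];
  exists r. Qed.

(** The two sides of a move join the same endpoints, so they transmit colours alike. The run from
    [s0] guarantees that [s] has enough strands for the windows of the pieces. *)
Lemma colorings_move a b s0 t0 v s : move a b -> run a s0 = Some t0 ->
  size s = size s0 -> colorings (a ++ v) s = colorings (b ++ v) s.
Proof.
move=> ab; case: a b / ab.
- move=> x y i d /run2[r /step_size[h1 h2] /step_size[h3 h4]] ss.
  have [|s1 [p [s' [Es si sp]]]] := @split_at i (win x) s; first by lia.
  have [|m [p' [s2 [Es' sm sp']]]] := @split_at d (win y) s'.
    by move: ss; rewrite Es !size_cat si sp; lia.
  rewrite Es Es' {s s' Es Es' ss} (@colorings_at x i) //.
  have E u w : s1 ++ u ++ m ++ w ++ s2 = (s1 ++ u ++ m) ++ w ++ s2 by rewrite -!catA.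
  (* The two orders of the pieces give the same double sum, with the summations exchanged. *)
  transitivity (\sum_(o <- outcomes x p) \sum_(o' <- outcomes y p')
     colorings v (s1 ++ o ++ m ++ o' ++ s2)).
    apply: eq_big_seq => o /size_outcomes so.
    rewrite E (@colorings_at y) ?size_cat ?si ?so ?sm ?addnA //.
    by apply: eq_bigr => o' _; rewrite -E.
  rewrite exchange_big /= E.
  rewrite (@colorings_at y) ?size_cat ?si ?sp ?sm ?addnA //; apply: eq_bigr => o' _.
  by rewrite -E (@colorings_at x i).
- move=> o i /run2[r /step_size[/= h1 h2] /step_size[/= h3 h4]] ss.
  have [|s1 [c [s2 [-> si]]]] := @split_at1 i s; first by lia.
  by rewrite /= !coloringsE //; case: c; rewrite ?addn0 ?add0n.
- move=> o i /run2[r /step_size[/= h1 h2] /step_size[/= h3 h4]] ss.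
  have [|s1 [c [s2 [-> si]]]] := @split_at1 i s; first by lia.
  by rewrite /= !coloringsE //; case: c; rewrite ?addn0 ?add0n.
- move=> o e i /run2[r /step_size[/= h1 h2] /step_size[/= h3 h4]] ss.
  have [|s1 [c [s2 [-> si]]]] := @split_at1 i s; first by lia.
  by rewrite /= !coloringsE.
- move=> e i /run2[r /step_size[/= h1 h2] /step_size[/= h3 h4]] ss.
  have [|s1 [a [b [c [s2 [-> si]]]]]] := @split_at3 i s; first by lia.
  by rewrite /= !coloringsE.
- move=> o e i /run2[r /step_size[/= h1 h2] /step_size[/= h3 h4]] ss.
  have [|s1 [[|? ?] [s2 [-> si]]]] // := @split_at i 0 s; first by lia.
  by rewrite /= !coloringsE.
- move=> e i /run2[r /step_size[/= h1 h2] /step_size[/= h3 h4]] ss.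
  have [|s1 [a [b [s2 [-> si]]]]] := @split_at2 i s; first by lia.
  by rewrite /= !coloringsE // eq_sym.
- move=> e i /run2[r /step_size[/= h1 h2] /step_size[/= h3 h4]] ss.
  have [|s1 [a [b [s2 [-> si]]]]] := @split_at2 i s; first by lia.
  by rewrite /= !coloringsE.
- move=> e1 e2 e3 i _; rewrite -cat1s run_cat run1.
  case E1: (step _ _) => [r1|] //= /run2[r2 /step_size[/= h1 h2] /step_size[/= h3 h4]] ss.
  have [/= h5 h6] := step_size E1.
  have [|s1 [a [b [c [s2 [-> si]]]]]] := @split_at3 i s; first by lia.
  by rewrite /= !coloringsE.
Qed.

Lemma colorings_context u a b s0 s : (forall r s1 s2, run a r = Some s2 -> size s1 = size
  r ->
    colorings a s1 = colorings b s1) -> run (u ++ a) s0 <> None -> size s = size s0 ->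
  colorings (u ++ a) s = colorings (u ++ b) s.
Proof.
move=> ab; elim: u s0 s => [|[x i] u IH] s0 s /=.
  by case E: (run a s0) => [t|] // _; apply: ab E.
case E: (step (x, i) s0) => [t|] //= ru ss.
have [le_s st] := step_size E.
apply: eq_big_seq => o /size_outcomes so; apply: (IH t) => //.
rewrite /replace_window !size_cat so size_takel ?size_drop; lia.
Qed.

Lemma colorings_isotopic w w' : isotopic w w' -> colorings w [::] = colorings w' [::].
Proof.
elim=> {w w'} [_ _ [u v a b ab da _]||w w' _ ->|w w' w'' _ -> _] //.
apply: (@colorings_context u (a ++ v) (b ++ v) [::]) => //.
  move=> r s1 s2; rewrite run_cat; case E: (run a r) => [t|] //= _.
  exact: colorings_move E.
by move: da; rewrite /is_diagram; case: run.
Qed.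

(** * Colourings of a knot diagram *)

Lemma run_take w k s : run w [::] = Some s -> run (take k w) [::] <> None.
Proof. by rewrite -{1}(cat_take_drop k w) run_cat; case: run. Qed.

(* [T] lists the sections above the pieces of [w] in a colouring of [w] whose
   lowest section is [s]. *)
Fixpoint coloring (w : word) (s : seq bool) (T : seq (seq bool)) : Prop :=
  match w, T with
  | [::], [::] => s = [::]
  | (x, i) :: w', s' :: T' =>
      (exists2 o, o \in outcomes x (window x i s) & s' = replace_window x i s o) /\
      coloring w' s' T'
  | _, _ => False
  end.

Lemma coloring_exists w s : 0 < colorings w s -> exists T, coloring w s T.
Proof.
elim: w s => [|[x i] w IH] s; first by rewrite /colorings lt0b => /eqP->; exists [::].
rewrite colorings_cons lt0n sum_nat_seq_neq0 => /hasP[o oo /=]; rewrite -lt0n => /IH[T cT].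
by exists (replace_window x i s o :: T); split=> //; exists o.
Qed.

(** Choices occur only at minima, and there the branch of the colour other than [c] has no
    extension. *)
Lemma colorings_le1 w s c :
  (forall T, coloring w s T -> forall k, all (pred1 c) (nth [::] T k)) ->
  colorings w s <= 1.
Proof.
elim: w s => [|[x i] w IH] s cT; first exact: leq_b1.
have IHo o : o \in outcomes x (window x i s) ->
    (0 < colorings w (replace_window x i s o) -> all (pred1 c) o) /\
    colorings w (replace_window x i s o) <= 1.
  move=> oo; split.
    move/coloring_exists=> [T wT].
    have /(_ 0) /= := cT (replace_window x i s o :: T) (conj (ex_intro2 _ _ o oo erefl) wT).
    by rewrite !all_cat => /and3P[].
  apply: IH => T wT k.
  exact: cT (replace_window x i s o :: T) (conj (ex_intro2 _ _ o oo erefl) wT) k.+1.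
rewrite colorings_cons; move: (window x i s) IHo => p.
case: x cT => [o'||e] _; case: p => [|a [|a' [|? ?]]] /=; rewrite ?big_nil //.
- move=> IHo; rewrite !big_cons big_nil addn0.
  have [] := IHo [:: true; true] (mem_head _ _).
  have [] := IHo [:: false; false] isT.
  case: c {IH IHo} => /= h1 h2 h3 h4.
    by case: (posnP (colorings w (replace_window (Cup o') i s [:: false;
      false]))) => [->|/h1//]; rewrite addn0.
  by case: (posnP (colorings w (replace_window (Cup o') i s [:: true;
    true]))) => [->|/h3//].
- move=> IHo; case: ifP IHo => [_ /(_ [::] (mem_head _ _))[_]|_ _]; last by rewrite big_nil.
  by rewrite big_cons big_nil addn0.
- by move=> /(_ _ (mem_head _ _))[_]; rewrite big_cons big_nil addn0.
Qed.

Lemma coloring_size w T s0 s k t : coloring w s T -> size s = size s0 ->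
  run (take k w) s0 = Some t -> k <= size w -> size (nth [::] (s :: T) k) = size t.
Proof.
elim: w T s0 s k => [|[x i] w IH] [|s' T] s0 s [|k] //=; try by move=> _ ? [<-].
move=> [[o /size_outcomes so ->] wT] ss.
case E: (step (x, i) s0) => [r|] //= rk lt_k.
apply: (IH T r) => //; have [le_s st] := step_size E.
rewrite /replace_window !size_cat so size_takel ?size_drop; lia.
Qed.
 
Lemma coloring_step w s T k x i : coloring w s T -> onth w k = Some (x, i) ->
  let S := nth [::] (s :: T) in
  exists2 o, o \in outcomes x (window x i (S k)) & S k.+1 = replace_window x i (S k) o.
Proof.
elim: w s T k => [|[y j] w IH] s [|s' T] [|k] //= [].
  by move=> h _ [<- <-].
by move=> _ wT wk; apply: IH wT wk.
Qed.

Lemma onth_split (T : Type) (w : seq T) k x : onth w k = Some x ->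
  k < size w /\ w = take k w ++ x :: drop k.+1 w.
Proof.
elim: w k => [|y w IH] [|k] //=; first by case=> ->; rewrite drop0.
by move/IH=> [lt_k Ew]; split=> //; rewrite {1}Ew.
Qed.

Lemma coloring_local w T k x i : is_diagram w -> coloring w [::] T ->
  onth w k = Some (x, i) -> let S := nth [::] ([::] :: T) in
  exists s1 p o s2, [/\ S k = s1 ++ p ++ s2, size s1 = i, size p = win x,
    o \in outcomes x p & S k.+1 = s1 ++ o ++ s2].
Proof.
move=> /eqP dw wT wk S; have [lt_k Ew] := onth_split wk.
move: dw; rewrite Ew run_cat; case Ek: (run (take k w) [::]) => [t|] //=.
case E: (step (x, i) t) => [r|] //= _.
have sk : size (S k) = size t by apply: coloring_size wT _ Ek (ltnW lt_k).
have [le_t _] := step_size E.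
have [s1 [p [s2 [Es si sp]]]] : exists s1 p s2, [/\ S k = s1 ++ p ++ s2, size s1 = i &
  size p = win x].
  by apply: split_at; rewrite sk.
have [o oo So] := coloring_step wT wk.
exists s1, p, o, s2; move: oo So; rewrite -/S Es /window /replace_window -si.
have Ed : drop (size s1 + size p) (s1 ++ p ++ s2) = s2.
  by rewrite catA -size_cat drop_size_cat.
by rewrite drop_size_cat // -sp !take_size_cat // Ed.
Qed.

Lemma nth_cat0 (T : Type) (x : T) s1 s2 : nth x (s1 ++ s2) (size s1) = nth x s2 0.
Proof. by rewrite nth_cat ltnn subnn. Qed.

Lemma nth_cat1 (T : Type) (x : T) s1 s2 : nth x (s1 ++ s2) (size s1).+1 = nth x s2 1.
Proof. by rewrite nth_cat ltnNge leqnSn subSnn. Qed.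

Lemma coloring_arc w T P Q : is_diagram w -> coloring w [::] T -> arc_step w P Q ->
  let col (X : point) := nth false (nth [::] ([::] :: T) X.1) X.2 in col P = col Q.
Proof.
move=> dw wT; have := @coloring_local w T _ _ _ dw wT.
move: (nth [::] ([::] :: T)) => /= S L.
case=> [k x i p|k x i d|k o i|k i|k e i|k e i] /= /L[s1 [r [o' [s2 [Ek <- sr oo EkS]]]]];
  rewrite ?Ek ?EkS {Ek EkS}.
- by move=> lt_p; rewrite !nth_cat lt_p.
- rewrite !catA !nth_cat !size_cat sr (size_outcomes oo).
  by rewrite !ltnNge !leq_addr /= !addKn.
- case: r sr oo => //= _; rewrite !inE ?nth_cat0 ?nth_cat1.
  by case/orP=> /eqP->.
- case: r sr oo => [|a [|b [|? ?]]] //= _; case: eqP => // -> _.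
  by rewrite ?nth_cat0 ?nth_cat1.
- case: r sr oo => [|a [|b [|? ?]]] //= _; rewrite inE => /eqP->.
  by rewrite ?nth_cat0 ?nth_cat1.
- case: r sr oo => [|a [|b [|? ?]]] //= _; rewrite inE => /eqP->.
  by rewrite ?nth_cat0 ?nth_cat1.
Qed.

(** The first minimum can take two colours, and each of them spreads along the arcs to all points of
    the connected diagram. *)
Lemma knot_colorings K : is_knot K -> colorings K [::] <= 2.
Proof.
case=> dK nK conK.
case: K nK dK conK => [//|[x i] w] _ dK conK.
move: (dK); rewrite /is_diagram /=; case E: (step (x, i) [::]) => [r|] //= /eqP rw.
(* The section below the first piece is empty, so this piece is a minimum at position 0. *)
have [/=] := step_size E; rewrite leqn0 addn_eq0 => /andP[/eqP i0 _] _.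
subst i; case: x E dK conK => [o||e]; [|by case..].
case=> Er dK conK; subst r.
suff le1 c : colorings w [:: c; c] <= 1.
  by rewrite (@colorings_cup o 0 w [::] [::]) // (leq_add (le1 true) (le1 false)).
apply: (@colorings_le1 _ _ c) => T wT k.
set K := (Cup o, 0) :: w in dK conK *.
have KT : coloring K [::] ([:: c; c] :: T).
  by split=> //; exists [:: c; c] => //; case: (c); rewrite !inE eqxx ?orbT.
pose S := nth [::] ([::] :: [:: c; c] :: T).
pose col (X : point) := nth false (S X.1) X.2.
have col_con P Q : clos_refl_sym_trans point (arc_step K) P Q -> col P = col Q.
  by elim=> {P Q} [P Q /(coloring_arc dK KT)|P|P Q _ ->|P Q R _ -> _ ->].
have sT : size T = size w.
  by elim: w T [:: c; c] wT {rw K dK conK KT S col col_con} => [|[x i] w IH] [|s T] r //=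
    [_ /IH->].
(* The entries of [T] start above the second piece, whence the shift by two. Past the last piece the
   default section is empty. *)
change (all (pred1 c) (S k.+2)).
have [le_k|lt_k] := leqP (size w) k; first by rewrite /S /= nth_default ?sT.
apply/(all_nthP false) => p lt_p; apply/eqP.
have pt10 : is_point K (1, 0) by rewrite /is_point /K /= take0.
suff pt : is_point K (k.+2, p) by exact: col_con (conK _ _ pt pt10).
split=> //=; move: (dK) => /eqP /(@run_take K k.+2) /=.
case Ek : (run (take k.+1 w) _) => [t|] //= _.
suff -> : size t = size (S k.+2) by [].
by symmetry; apply: (@coloring_size K _ [::] [::] k.+2 t KT).
Qed.

(** * Colourings of a closed braid *)

Fixpoint bitseqs n : seq (seq bool) :=
  if n is n'.+1 then [seq rcons s true | s <- bitseqs n'] ++ [seq rcons s false | s <-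
    bitseqs n']
  else [:: [::]].

Lemma mem_bitseqs n s : (s \in bitseqs n) = (size s == n).
Proof.
elim: n s => [|n IH] s; first by rewrite inE size_eq0.
case/lastP: s => [|s c].
  by rewrite mem_cat; apply/orP => -[]/mapP[[|? ?] _].
have inj x : injective (rcons^~ x : seq bool -> _) by move=> u v /rcons_inj[].
rewrite size_rcons eqSS -IH mem_cat; case: c.
  rewrite (mem_map (inj true)) [X in _ || X](_ : _ = false) ?orbF //.
  by apply/mapP => -[u _ /rcons_inj[]].
rewrite (mem_map (inj false)) [X in X || _](_ : _ = false) //.
by apply/mapP => -[u _ /rcons_inj[]].
Qed.

Lemma bitseqs_uniq n : uniq (bitseqs n).
Proof.
elim: n => //= n IH; have inj x : injective (rcons^~ x : seq bool -> _) by move=> u v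
  /rcons_inj[].
rewrite cat_uniq !map_inj_uniq ?IH //= andbT; apply/hasPn => _ /mapP[u _ ->].
by apply/mapP => -[v _ /rcons_inj[]].
Qed.

(** Nested minima colour a palindromic section. [bitseqs] grows at the end because the newest
    minimum is the innermost. *)
Lemma colorings_cups n w :
  colorings (cups n ++ w) [::] = \sum_(s <- bitseqs n) colorings w (s ++ rev s).
Proof.
elim: n w => [|n IH] w; first by rewrite big_cons big_nil addn0.
rewrite cupsS cat_rcons IH /= big_cat !big_map /= -big_split /=.
apply: eq_big_seq => s; rewrite mem_bitseqs => /eqP ss.
by rewrite colorings_cup // !rev_rcons !cat_rcons.
Qed.

Lemma colorings_caps n s s' : size s = n -> size s' = n ->
  colorings (caps n) (s ++ rev s') = (s == s').
Proof.
elim: n s s' => [|n IH] s s'; first by move=> /size0nil-> /size0nil->.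
case/lastP: s => // s c; case/lastP: s' => // s' c'.
rewrite !size_rcons => -[ss] [ss']; rewrite capsS rev_rcons cat_rcons colorings_cap //.
by rewrite eqseq_rcons IH // andbC; case: eqP.
Qed.

Section Closure.
Variable m : nat.

Definition section_of (F : 'I_m.+1 -> bool) : seq bool := mkseq (fun k => F (inord k)) m.+1.

Lemma eq_section F G : F =1 G -> section_of F = section_of G.
Proof. by move=> FG; apply: eq_mkseq => k; apply: FG. Qed.

(** The factors are ordered so that colours [F] below the crossings become [F \o crossing_perm w]
    above them. *)
Definition crossing_perm (w : seq (nat * bool)) : {perm 'I_m.+1} :=
  foldr (fun g p => (p * tperm (inord g.1) (inord g.1.+1))%g) 1%g w.

Lemma colorings_crossing e i w F r : i.+1 < m.+1 ->
  colorings ((Cross e, i) :: w) (section_of F ++ r) =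
  colorings w (section_of (F \o tperm (inord i) (inord i.+1)) ++ r).
Proof.
move=> lt_i; rewrite /section_of /mkseq.
have -> : iota 0 m.+1 = iota 0 i ++ [:: i; i.+1] ++ iota i.+2 (m.+1 - i.+2).
  by rewrite -[in LHS](subnKC lt_i) -addn2 -addnA !iotaD add0n.
rewrite !map_cat /= -!catA /= colorings_cross ?size_map ?size_iota // tpermL tpermR.
have out k : k < m.+1 -> k != i -> k != i.+1 ->
    F (tperm (inord i) (inord i.+1) (inord k)) = F (inord k).
  move=> lt_k ki kSi; rewrite tpermD // -val_eqE /= !inordK // 1?eq_sym //.
  exact: ltnW.
congr (colorings w (_ ++ [:: _, _ & _ ++ r])); apply/eq_in_map => k;
  rewrite mem_iota => lt_k; rewrite out //; lia.
Qed.

Lemma colorings_crossings w v F r : on_strands m.+1 w ->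
  colorings (crossings w ++ v) (section_of F ++ r) =
  colorings v (section_of (F \o crossing_perm w) ++ r).
Proof.
elim: w F => [|[i e] w IH] F.
  move=> _; apply: (congr1 (fun s => colorings v (s ++ r))).
  by apply: eq_section => k /=; rewrite perm1.
move=> /andP[lt_i wn].
rewrite -[crossings _ ++ v]/((Cross e, i) :: (crossings w ++ v)).
rewrite colorings_crossing // IH //; apply: (congr1 (fun s => colorings v (s ++ r))).
by apply: eq_section => k /=; rewrite permM.
Qed.

Lemma odd_crossing_perm w : on_strands m.+1 w -> odd_perm (crossing_perm w) = odd (size w).
Proof.
elim: w => [|[i e] w IH] /=; first by rewrite odd_perm1.
move=> /andP[lt_i wn]; rewrite odd_permM IH // odd_tperm addbC.
by rewrite -val_eqE /= !inordK ?(ltnW lt_i) // neq_ltn ltnSn.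
Qed.

Lemma size_section F : size (section_of F) = m.+1.
Proof. exact: size_mkseq. Qed.

Lemma colorings_invariant F w : on_strands m.+1 w ->
  (forall k, F (crossing_perm w k) = F k) -> 
  colorings (crossings w ++ caps m.+1) (section_of F ++ rev (section_of F)) = 1.
Proof.
move=> wn Fw; rewrite colorings_crossings // -[RHS]/(nat_of_bool true) colorings_caps
  ?size_section //.
by congr nat_of_bool; apply/eqP; apply: eq_mkseq => k /=.
Qed.

(** The two constant colourings and [F] are distinct, and each extends over the closure. *)
Lemma colorings_ge3 (F : pred 'I_m.+1) w : on_strands m.+1 w ->
  (forall k, F (crossing_perm w k) = F k) -> (exists i, F i) -> (exists i, ~~ F i) ->
  2 < colorings (braid_diagram m.+1 w) [::].
Proof.
move=> wn Fw [i Fi] [j Fj].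
pose L := [:: section_of (fun=> true); section_of (fun=> false); section_of F].
have secE G G' k : section_of G = section_of G' -> G k = G' k.
  move=> /(congr1 (fun s => nth false s k)).
  by rewrite !nth_mkseq ?ltn_ord // inord_val.
have uL : uniq L.
  rewrite /L !cons_uniq !inE !negb_or andbT -andbA; apply/and3P; split=> //; apply/eqP.
  - by move/(secE _ _ j) => /= E; rewrite -E in Fj.
  - by move/(secE _ _ i) => /= E; rewrite -E in Fi.
rewrite /braid_diagram colorings_cups.
have -> : 3 = \sum_(s <- L) colorings (crossings w ++ caps m.+1) (s ++ rev s).
  by rewrite !big_cons big_nil !colorings_invariant.
have pL : perm_eq L [seq s <- bitseqs m.+1 | s \in L].
  apply: uniq_perm; rewrite ?filter_uniq ?bitseqs_uniq // => s.
  rewrite mem_filter mem_bitseqs; case: (boolP (s \in L)) => //= sL.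
  by move: sL; rewrite !inE => /or3P[]/eqP->; rewrite size_section eqxx.
rewrite (perm_big _ pL) big_filter [leqRHS](bigID (mem L)) /=.
exact: leq_addr.
Qed.

(** Two colourings leave room for a single orbit, so the permutation is a cycle of length [m + 1],
    of parity [m]; each crossing contributes a transposition. *)
Lemma crossing_perm_transitive w : on_strands m.+1 w ->
  colorings (braid_diagram m.+1 w) [::] <= 2 -> odd (size w) = odd m.
Proof.
move=> wn le2; set s := crossing_perm w.
pose F k := k \in porbit s ord0.
have Fs k : F (s k) = F k.
  by have := porbit_perm s 1 k; rewrite expg1 /F -!eq_porbit_mem => ->.
have F0 : F ord0 by exact: porbit_id.
have Fall k : F k.
  (* otherwise the indicator of an orbit is a third invariant colouring *)
  apply: contraLR le2 => nFk; rewrite -ltnNge; apply: (@colorings_ge3 F) => //.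
    by exists ord0.
  by exists k.
have -> : odd (size w) = odd_perm s by rewrite odd_crossing_perm.
have orb : porbits s = [set porbit s ord0].
  apply/setP => O; rewrite inE; apply/imsetP/eqP => [[k _ ->]|->]; last by exists ord0.
  by apply/eqP; rewrite eq_porbit_mem; apply: Fall.
by rewrite /odd_perm orb cards1 card_ord /= addbT negbK.
Qed.
End Closure.

(** * Reduction in the Hecke algebra *)

Definition zA : QqA := inA (q - q^-1)%R.

(** The values on braid words of a linear functional on the Hecke algebra, with quadratic relation
    [sigma - sigma^-1 = z] for [z = q - q^-1]. *)
Record hecke n (phi : seq (nat * bool) -> QqA) : Prop := Hecke {
  hecke_skein : forall u v i, on_strands n u -> on_strands n v -> i.+1 < n ->
    (phi (u ++ (i, true) :: v) - phi (u ++ (i, false) :: v) = zA * phi (u ++ v))%R;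
  hecke_R2 : forall u v i e, on_strands n u -> on_strands n v -> i.+1 < n ->
    phi (u ++ [:: (i, e), (i, ~~ e) & v]) = phi (u ++ v);
  hecke_R3 : forall u v i, on_strands n u -> on_strands n v -> i.+2 < n ->
    phi (u ++ [:: (i.+1, true), (i, true), (i.+1, true) & v]) =
    phi (u ++ [:: (i, true), (i.+1, true), (i, true) & v]);
  hecke_comm : forall u v i j e f, on_strands n u -> on_strands n v ->
    i.+1 < j -> j.+1 < n ->
    phi (u ++ [:: (j, f), (i, e) & v]) = phi (u ++ [:: (i, e), (j, f) & v]) }.

(** In use, the degree records, up to a shift, the sign under [q -> q^-1], for which [q - q^-1] is
    odd. *)
Record graded (V : bool -> QqA -> Prop) : Prop := Graded {
  gradedD : forall e x y, V e x -> V e y -> V e (x + y)%R;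
  gradedN : forall e x, V e x -> V e (- x)%R;
  gradedz : forall e x, V e x -> V (~~ e) (zA * x)%R }.

(* The word [w] is, up to the Hecke relations, a combination of words of [S]
   whose coefficients are polynomials in [q - q^-1] of the parity prescribed by
   the lengths. *)
Definition reduces n (S : seq (nat * bool) -> Prop) w : Prop :=
  forall V phi, graded V -> hecke n phi ->
    (forall s, S s -> V (odd (size s)) (phi s)) -> V (odd (size w)) (phi w).

Lemma hecke_context n phi u v : on_strands n u -> on_strands n v ->
  hecke n phi -> hecke n (fun w => phi (u ++ w ++ v)).
Proof.
move=> un vn [sk r2 r3 co];
  have cn x y : on_strands n x -> on_strands n y -> on_strands n (x ++ y).
  by rewrite on_strands_cat => -> ->.
split=> [x y i|x y i e|x y i|x y i j e f] xn yn lt_in;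
  rewrite -!catA !catA -!(catA (u ++ x)) /=.
- by apply: sk => //; apply: cn.
- by apply: r2 => //; apply: cn.
- by apply: r3 => //; apply: cn.
- by apply: co => //; apply: cn.
Qed.

Lemma hecke_le n phi : hecke n.+1 phi -> hecke n phi.
Proof.
have up := @on_strandsS n.
case=> sk r2 r3 co; split=> [x y i|x y i e|x y i|x y i j e f] /up xn /up yn lt_in.
- by apply: sk => //; apply: ltnW.
- by apply: r2 => //; apply: ltnW.
- by apply: r3 => //; apply: ltnW.
- by move=> lt_jn; apply: co => //; apply: ltnW.
Qed.

Lemma reduces_le n S w : reduces n S w -> reduces n.+1 S w.
Proof. by move=> red V phi gV /hecke_le; apply: (red V phi gV). Qed.

Lemma reduces_mem n (S : _ -> Prop) w : S w -> reduces n S w.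
Proof. by move=> Sw V phi _ _ VS; apply: (VS w Sw). Qed.

Lemma reduces_context n (S T : _ -> Prop) u v w : on_strands n u -> on_strands n v ->
  reduces n S w -> (forall s, S s -> reduces n T (u ++ s ++ v)) ->
  reduces n T (u ++ w ++ v).
Proof.
move=> un vn redw redS V phi gV hphi VT.
(* The context shifts the degree by the parity of its length. *)
pose V' e := V (odd (size u) (+) e (+) odd (size v)).
have gV' : graded V'.
  case: gV => gD gN gz; split=> [e x y|e x|e x]; [exact: gD|exact: gN|].
  by move/gz; rewrite /V' addbN addNb.
rewrite !size_cat !oddD addbA.
apply: (redw V' _ gV' (hecke_context un vn hphi)) => s /redS /(_ V phi gV hphi VT).
by rewrite !size_cat !oddD addbA.
Qed.

Lemma reduces_eq n S w w' : odd (size w) = odd (size w') ->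
  (forall phi, hecke n phi -> phi w = phi w') -> reduces n S w' -> reduces n S w.
Proof. by move=> sz eqw red V phi gV hphi VS; rewrite eqw // sz;
  exact: (red V phi gV hphi VS). Qed.

(** This is [sigma^-1 = sigma - z]: dropping a letter changes the parity of the length, just as [z]
    changes the degree. *)
Lemma reduces_neg n S u v i : on_strands n u -> on_strands n v -> i.+1 < n ->
  reduces n S (u ++ (i, true) :: v) -> reduces n S (u ++ v) ->
  reduces n S (u ++ (i, false) :: v).
Proof.
move=> un vn lt_in red1 red0 V phi gV hphi VS.
have := hecke_skein hphi un vn lt_in.
move/eqP; rewrite GRing.subr_eq GRing.addrC -GRing.subr_eq => /eqP <-.
have -> : size (u ++ (i, false) :: v) = size (u ++ (i, true) :: v) by rewrite !size_cat.
apply: gradedD (red1 V phi gV hphi VS) _ => //.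
apply: gradedN => //; have := gradedz gV (red0 V phi gV hphi VS).
by rewrite !size_cat /= !addnS.
Qed.

(** This is [sigma^2 = 1 + z sigma]: the skein relation at the second letter, with [sigma sigma^-1]
    cancelled. *)
Lemma reduces_square n S u v i : on_strands n u -> on_strands n v -> i.+1 < n ->
  reduces n S (u ++ v) -> reduces n S (u ++ (i, true) :: v) ->
  reduces n S (u ++ [:: (i, true), (i, true) & v]).
Proof.
move=> un vn lt_in red0 red1 V phi gV hphi VS.
have ivn : on_strands n ((i, true) :: v) by rewrite /= lt_in.
have uin : on_strands n (u ++ [:: (i, true)]) by rewrite on_strands_cat un /= lt_in.
have := hecke_skein hphi uin vn lt_in; rewrite -!catA /=.
move/eqP; rewrite (hecke_R2 hphi true un vn lt_in) GRing.subr_eq => /eqP ->.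
rewrite !size_cat /= !addnS /= negbK; apply: gradedD => //.
  have := gradedz gV (red1 V phi gV hphi VS).
  by rewrite !size_cat /= !addnS /= negbK.
by have := red0 V phi gV hphi VS; rewrite size_cat.
Qed.

Lemma hecke_comm_word n phi u v w e : hecke n.+2 phi ->
  on_strands n.+2 u -> on_strands n.+2 v -> on_strands n w ->
  phi (u ++ (n, e) :: w ++ v) = phi (u ++ w ++ (n, e) :: v).
Proof.
move=> hphi un vn; elim: w u un => // -[i f] w IH u un /= /andP[/= lt_in wn].
have wn2 := on_strandsS (on_strandsS wn).
rewrite (hecke_comm hphi) //; last by rewrite on_strands_cat wn2.
have uin : on_strands n.+2 (u ++ [:: (i, f)]).
  by rewrite on_strands_cat un /=; apply/andP; split=> //; apply: leqW; apply: leqW.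
by have := IH _ uin wn; rewrite -!catA.
Qed.

(** Words spanning [B + B sigma B], where [B] is the Hecke algebra on one strand fewer and [sigma]
    is the last generator. *)
Definition normal n (w : seq (nat * bool)) : Prop :=
  on_strands n.+1 w \/
  exists a b, [/\ on_strands n.+1 a, on_strands n.+1 b & w = a ++ (n, true) :: b].

Lemma normal_on_strands n w : normal n w -> on_strands n.+2 w.
Proof.
case=> [/on_strandsS //|[a [b [/on_strandsS an /on_strandsS bn ->]]]].
by rewrite on_strands_cat an /= ltnSn.
Qed.

Lemma normal_catr n u w : normal n w -> on_strands n.+1 u -> normal n (w ++ u).
Proof.
move=> [wn|[a [b [an bn ->]]]] un; [left|right]; rewrite ?on_strands_cat ?un ?andbT //.
by exists a, (b ++ u); rewrite on_strands_cat bn un -catA.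
Qed.

(* A word with two occurrences of the last generator is the only obstruction. *)
Lemma reduces_normal_square n :
  (forall a b, on_strands n.+1 a -> on_strands n.+1 b ->
    reduces n.+2 (normal n) (a ++ (n, true) :: b ++ [:: (n, true)])) ->
  forall w, on_strands n.+2 w -> reduces n.+2 (normal n) w.
Proof.
move=> sq; elim/last_ind=> [|w [i e] IHw]; first by move=> _; apply: reduces_mem; left.
rewrite -cats1 on_strands_cat => /andP[wn gn].
move: (gn); rewrite /= andbT ltnS => lt_in.
apply: (@reduces_context _ _ _ [::] [:: (i, e)]) (IHw wn) _ => // s Ns /=.
have sn := normal_on_strands Ns.
suff red : reduces n.+2 (normal n) (s ++ [:: (i, true)]).
  by case: e {gn} => //; apply: reduces_neg => //; apply: reduces_mem; rewrite cats0.
move: lt_in; rewrite leq_eqVlt eqSS => /orP[/eqP ->|lt_in]; last first.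
  by apply: reduces_mem; apply: normal_catr => //=; rewrite lt_in.
case: Ns => [sn'|[a [b [an bn ->]]]]; first by apply: reduces_mem; right; exists s, [::].
by rewrite -catA; apply: sq.
Qed.

(** Between two occurrences of the last generator, [b] lives on one strand fewer and reduces by
    induction to words with at most one occurrence of the generator before it. *)
Lemma reduces_normal n w : on_strands n.+2 w -> reduces n.+2 (normal n) w.
Proof.
elim: n w => [|n IHn]; apply: reduces_normal_square => a b an bn.
  (* On two strands [b] is empty and the two letters form a square. *)
  case: b bn => // _; apply: reduces_square => //=; first exact: on_strandsS.
    by apply: reduces_mem; left; rewrite cats0.
  by apply: reduces_mem; right; exists a, [::].
rewrite -cat1s catA.
apply: (@reduces_context _ _ _ (a ++ [:: (n.+1, true)]) [:: (n.+1, true)])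
  (reduces_le (IHn _ bn)) _; rewrite /= ?ltnSn //.
  by rewrite on_strands_cat (on_strandsS an) /= ltnSn.
have an' := on_strandsS an.
move=> t [tn|[c [d [cn dn ->]]]]; rewrite -!catA /=.
  (* Here [t] avoids generator [n], so generator [n.+1] commutes past it and forms a square. *)
  have tn' := on_strandsS tn.
  apply: (@reduces_eq _ _ _ ((a ++ t) ++ [:: (n.+1, true); (n.+1, true)])).
  - by rewrite !size_cat /= !size_cat /=; congr odd; lia.
  - by move=> phi hphi; rewrite (hecke_comm_word _ hphi) /= ?ltnSn -?catA.
  have atn : on_strands n.+2 (a ++ t) by rewrite on_strands_cat an tn'.
  apply: reduces_square; [exact: on_strandsS|by []|exact: ltnSn| |].
    by apply: reduces_mem; left; rewrite cats0.
  by apply: reduces_mem; right; exists (a ++ t), [::].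
(* Here the two letters [n.+1] move inwards past [c] and [d] until they enclose the letter [n]; the
   braid relation then leaves a single [n.+1]. *)
have cn' := on_strandsS cn; have dn' := on_strandsS dn.
apply: (@reduces_eq _ _ _ ((a ++ c ++ [:: (n, true)]) ++ (n.+1, true) :: (n, true) :: d)).
- by rewrite !size_cat /= !size_cat /= ?size_cat /= ?size_cat /=; congr odd; lia.
- move=> phi hphi.
  have dn3 := on_strandsS dn'; have cn3 := on_strandsS cn'.
  rewrite (hecke_comm_word _ hphi) //=; last first.
    by rewrite on_strands_cat /= dn3 ltnSn !andbT; apply: leqW.
  rewrite !catA.
  have := @hecke_comm_word n.+1 phi (a ++ c ++ [:: (n.+1, true);
    (n, true)]) [::] d true hphi.
  rewrite -!catA /= cats0 => <- //.
    rewrite !(catA a c) (hecke_R3 hphi) // on_strands_cat an' //=.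
  by rewrite !on_strands_cat an' cn3 /= ltnSn; rewrite leqW.
apply: reduces_mem; right; exists (a ++ c ++ [:: (n, true)]), ((n, true) :: d).
by rewrite /= ltnSn dn' !on_strands_cat an cn' /= ltnSn.
Qed.

Local Open Scope ring_scope.

(** * The involution exchanging q and 1/q *)

Section FractionLift.
Variables (R : idomainType) (F : fieldType) (f : {rmorphism R -> F}).
Hypothesis f_neq0 : forall x : R, x != 0 -> f x != 0.

Lemma fraction_numden (x : {fraction R}) :
  x = tofrac (frac (repr x)).1 / tofrac (frac (repr x)).2.
Proof.
have d0 : (frac (repr x)).2 != 0 by exact: denom_ratioP.
apply: (mulIf (x := tofrac (frac (repr x)).2)); first by rewrite tofrac_eq0.
rewrite divfK ?tofrac_eq0 //.
rewrite -{1}[x]reprK; move: (repr x) d0 => r d0.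
unlock FracField.tofrac; rewrite -[LHS]FracField.pi_mul /FracField.mulf /=.
rewrite !numden_Ratio ?oner_neq0 // mulr1; apply/eqmodP => /=.
by rewrite FracField.equivfE !numden_Ratio ?oner_neq0 // !mulr1 mulrC.
Qed.

Lemma fractionP (x : {fraction R}) :
  exists n d : R, d != 0 /\ x = tofrac n / tofrac d.
Proof. by exists (frac (repr x)).1, (frac (repr x)).2; split;
  [exact: denom_ratioP|exact: fraction_numden]. Qed.

(** The extension of [f] given by the universal property of the fraction field, computed on a chosen
    representative. *)
Definition fraction_lift (x : {fraction R}) : F :=
  f (frac (repr x)).1 / f (frac (repr x)).2.

Lemma fraction_liftE n d : d != 0 -> fraction_lift (tofrac n / tofrac d) = f n / f d.
Proof.
move=> d0; rewrite /fraction_lift; set x := tofrac n / tofrac d.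
have d'0 : (frac (repr x)).2 != 0 by exact: denom_ratioP.
apply/eqP; rewrite eqr_div ?f_neq0 // -!rmorphM; apply/eqP; congr (f _).
apply/eqP; rewrite -tofrac_eq !tofracM.
by rewrite -eqr_div ?tofrac_eq0 // -fraction_numden.
Qed.

Lemma fraction_lift_tofrac n : fraction_lift (tofrac n) = f n.
Proof. by rewrite -[tofrac n]divr1 -tofrac1 fraction_liftE ?oner_neq0 // rmorph1 divr1. Qed.

Lemma fraction_lift_zmod_morphism : zmod_morphism fraction_lift.
Proof.
move=> x y; have [n [d [d0 ->]]] := fractionP x; have [m [e [e0 ->]]] := fractionP y.
have E : tofrac n / tofrac d - tofrac m / tofrac e = tofrac (n * e - m * d) / tofrac (d *
  e).
  by rewrite tofracB !tofracM -mulNr addf_div ?tofrac_eq0 // mulNr.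
rewrite E !fraction_liftE ?mulf_neq0 // rmorphB !rmorphM -[- (f m / _)]mulNr addf_div
  ?f_neq0 //.
by rewrite mulNr.
Qed.

Lemma fraction_lift_monoid_morphism : monoid_morphism fraction_lift.
Proof.
split=> [|x y]; first by rewrite -tofrac1 fraction_lift_tofrac rmorph1.
have [n [d [d0 ->]]] := fractionP x; have [m [e [e0 ->]]] := fractionP y.
by rewrite mulf_div -!tofracM !fraction_liftE ?mulf_neq0 // !rmorphM mulf_div.
Qed.

End FractionLift.

HB.instance Definition _ := GRing.RMorphism.copy inA (@tofrac _ \o polyC).

Lemma q_neq0 : q != 0.
Proof. by rewrite tofrac_eq0 polyX_eq0. Qed.

Lemma A_neq0 : A != 0.
Proof. by rewrite tofrac_eq0 polyX_eq0. Qed.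

Definition ratq : rat -> Qq := @tofrac _ \o polyC.
HB.instance Definition _ := GRing.RMorphism.copy ratq (@tofrac _ \o polyC).

Definition eval_qV : {poly rat} -> Qq := horner_eval q^-1 \o map_poly ratq.
HB.instance Definition _ := GRing.RMorphism.copy eval_qV (horner_eval q^-1 \o map_poly
  ratq).

Lemma tofrac_polyE (p : {poly rat}) : tofrac p = (map_poly ratq p).[q].
Proof.
elim/poly_ind: p => [|p c IH]; first by rewrite tofrac0 map_poly0 horner0.
by rewrite tofracD tofracM IH [map_poly _ (_ + _)]rmorphD rmorphM /= map_polyX map_polyC
  hornerMXaddC.
Qed.

(* The reversed polynomial shows that [q^-1] is transcendental. *)
Lemma eval_qV_neq0 (p : {poly rat}) : p != 0 -> eval_qV p != 0.
Proof.
move=> p0; pose r := \poly_(i < size p) p`_((size p).-1 - i).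
have sp : (0 < size p)%N by rewrite lt0n size_poly_eq0.
have r0 : r != 0.
  apply/eqP => /(congr1 (fun s : {poly rat} => s`_0)).
  rewrite coef_poly sp subn0 coef0 => /eqP; rewrite -/(lead_coef p) lead_coef_eq0.
  exact/negP.
suff E : eval_qV p * q ^+ (size p).-1 = tofrac r.
  apply: contra_neq r0 => p'0; apply/eqP; rewrite -tofrac_eq0 -E p'0.
  by rewrite mul0r.
rewrite tofrac_polyE /eval_qV /= /horner_eval.
have ratq_inj : injective ratq by exact: fmorph_inj.
rewrite (horner_coef_wide _ (n := size p)); last by rewrite size_map_inj_poly ?rmorph0.
rewrite [RHS](horner_coef_wide _ (n := size p)); last first.
  by rewrite size_map_inj_poly ?rmorph0 // size_poly.
rewrite mulr_suml [RHS](reindex_inj rev_ord_inj) /=; apply: eq_bigr => i _.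
rewrite !coef_map /= coef_poly rev_ord_proof.
case: i => i /=; move: (size p) sp => s s0 lt_is.
have -> : (s.-1 - (s - i.+1) = i)%N by lia.
rewrite -mulrA; congr (_ * _).
have -> : (s.-1 = i + (s - i.+1))%N by lia.
by rewrite exprD mulrA -exprMn mulVf ?q_neq0 // expr1n mul1r.
Qed.

Definition invert_q : Qq -> Qq := fraction_lift eval_qV.
HB.instance Definition _ := GRing.isZmodMorphism.Build Qq Qq invert_q
  (fraction_lift_zmod_morphism eval_qV_neq0).
HB.instance Definition _ := GRing.isMonoidMorphism.Build Qq Qq invert_q
  (fraction_lift_monoid_morphism eval_qV_neq0).

Lemma invert_qq : invert_q q = q^-1.
Proof.
rewrite /invert_q fraction_lift_tofrac; last exact: eval_qV_neq0.
by rewrite /= /eval_qV /= map_polyX /horner_eval hornerX.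
Qed.

Lemma invert_qz : invert_q (q - q^-1) = - (q - q^-1).
Proof. by rewrite rmorphB fmorphV /= invert_qq invrK opprB. Qed.

Lemma qX_neq1 n : (0 < n)%N -> q ^+ n != 1.
Proof.
move=> n0; rewrite -tofracXn -tofrac1 tofrac_eq; apply/eqP.
move/(congr1 (fun p : {poly rat} => size p)); rewrite size_polyXn size_poly1 => -[E].
by rewrite E in n0.
Qed.

Lemma subV_neq0 (F : fieldType) (x : F) : x != 0 -> x ^+ 2 != 1 -> x - x^-1 != 0.
Proof.
move=> x0; apply: contra_neq => /eqP; rewrite subr_eq0 => /eqP E.
by rewrite expr2 {1}E mulVf.
Qed.

Lemma z_neq0 : q - q^-1 != 0.
Proof. exact: subV_neq0 q_neq0 (qX_neq1 _). Qed.

(** * The Morton-Franks-Williams bound *)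

Definition writhe (w : seq (nat * bool)) : int := \sum_(g <- w) (if g.2 then 1 else -1).

(** This normalisation removes [A] from the skein relation, which becomes the Hecke relation, and
    moves it into the stabilisation factor. *)
Definition trace_poly (H : word -> QqA) n w : QqA := A ^ writhe w * H (braid_diagram n w).

Lemma writhe_cat u v : writhe (u ++ v) = writhe u + writhe v.
Proof. exact: big_cat. Qed.

Lemma writhe_cons g w : writhe (g :: w) = (if g.2 then 1 else -1) + writhe w.
Proof. exact: big_cons. Qed.

Lemma expfz_shift (F : fieldType) (a : F) (n m : int) : a != 0 ->
  a ^ (n + (1 + m)) = a ^ (n + m) * a /\ a ^ (n + (-1 + m)) = a ^ (n + m) * a^-1.
Proof.
move=> a0; rewrite ![n + (_ + m)]addrCA ![_ + (n + m)]addrC.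
by rewrite !(expfzDr _ _ a0) expr1z.
Qed.

Lemma odd_writhe w : odd `|writhe w|%N = odd (size w).
Proof.
elim: w => [|[i e] w IH]; first by rewrite /writhe big_nil.
by rewrite writhe_cons /= -IH; case: e => /=; lia.
Qed.

Section Trace.
Variables (H : word -> QqA) (H_HOMFLYPT : is_HOMFLYPT H).

Lemma trace_isotopic n m u v : isotopic (braid_diagram n u) (braid_diagram m v) ->
  writhe u = writhe v -> trace_poly H n u = trace_poly H m v.
Proof. by move=> /(HOMFLYPT_isotopy H_HOMFLYPT) E w; rewrite /trace_poly E w. Qed.

Lemma trace_skein n u v i : on_strands n u -> on_strands n v -> (i.+1 < n)%N ->
  trace_poly H n (u ++ (i, true) :: v) - trace_poly H n (u ++ (i, false) :: v)
  = zA * trace_poly H n (u ++ v).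
Proof.
move=> un vn lt_in.
have Ebs : braid_section n = nseq i true ++ [:: true, true & nseq (n - i.+2) true ++ nseq
  n false].
  rewrite /braid_section -{1}(subnKC lt_in) -addn2 -addnA nseqD -catA.
  by rewrite nseqD.
have := @HOMFLYPT_skein _ H_HOMFLYPT (cups n ++ crossings u) (crossings v ++ caps n)
  (nseq i true) (nseq (n - i.+2) true ++ nseq n false) true true.
rewrite size_nseq /= run_cat run_cups /= run_crossings_braid // Ebs => /(_ erefl).
have E b : (cups n ++ crossings u) ++ (Cross b, i) :: crossings v ++ caps n
    = braid_diagram n (u ++ (i, b) :: v) by rewrite /braid_diagram crossings_cat -!catA.
rewrite !E; have -> : (cups n ++ crossings u) ++ crossings v ++ caps n = braid_diagram n
  (u ++ v).
  by rewrite /braid_diagram crossings_cat -!catA.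
have D : is_diagram (braid_diagram n (u ++ (i, true) :: v)).
  by apply: is_diagram_closure; rewrite on_strands_cat un /= lt_in.
move=> /(_ D); rewrite /trace_poly !writhe_cat !writhe_cons /=.
have [-> ->] := expfz_shift (writhe u) (writhe v) A_neq0.
by rewrite -!mulrA -mulrBr => ->; rewrite mulrCA.
Qed.

Lemma hecke_trace n : hecke n (trace_poly H n).
Proof.
split=> [u v i|u v i e|u v i|u v i j e f] un vn lt_in.
- exact: trace_skein.
- apply: trace_isotopic; first exact: closure_R2.
  by rewrite !writhe_cat !writhe_cons /=; case: e => /=; lia.
- apply: trace_isotopic; first exact/rst_sym/closure_R3.
  by rewrite !writhe_cat !writhe_cons.
- move=> lt_jn; apply: trace_isotopic; first exact/rst_sym/closure_comm.
  by rewrite !writhe_cat !writhe_cons /= [X in _ + X]addrCA.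
Qed.

Lemma trace_conj n u v : on_strands n u -> on_strands n v ->
  trace_poly H n (u ++ v) = trace_poly H n (v ++ u).
Proof.
by move=> un vn; apply: trace_isotopic; [exact: closure_conj|rewrite !writhe_cat addrC].
Qed.

Lemma trace_stab n w e : on_strands n.+1 w ->
  trace_poly H n.+2 (rcons w (n, e)) = (if e then A else A^-1) * trace_poly H n.+1 w.
Proof.
move=> wn; rewrite /trace_poly (HOMFLYPT_isotopy H_HOMFLYPT (closure_stab e wn)).
rewrite mulrA; congr (_ * _); rewrite -cats1 writhe_cat writhe_cons /=.
rewrite addrA [writhe [::]]big_nil addr0 (expfzDr _ _ A_neq0) mulrC.
by case: e.
Qed.

Lemma zA_neq0 : zA != 0.
Proof. by rewrite /zA fmorph_eq0 z_neq0. Qed.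

(** Both signs of an added last crossing are stabilisations of the same closure, so the skein
    relation between them evaluates the diagram with a split strand. *)
Lemma trace_split n w : on_strands n.+1 w ->
  trace_poly H n.+2 w = zA^-1 * ((A - A^-1) * trace_poly H n.+1 w).
Proof.
move=> wn; have := @trace_skein n.+2 w [::] n (on_strandsS wn) isT (ltnSn _).
rewrite !cats1 !trace_stab // cats0 -mulrBl => ->.
by rewrite mulKf // zA_neq0.
Qed.

(** Conjugation brings the last generator to the end of the word, where a destabilisation removes
    it. *)
Lemma trace_normal n u v : on_strands n.+1 u -> on_strands n.+1 v ->
  trace_poly H n.+2 (u ++ (n, true) :: v) = A * trace_poly H n.+1 (v ++ u).
Proof.
move=> un vn; have un' : on_strands n.+2 (rcons u (n, true)).
  by rewrite -cats1 on_strands_cat (on_strandsS un) /= ltnSn.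
rewrite -cat_rcons (trace_conj un' (on_strandsS vn)).
by rewrite -rcons_cat trace_stab // on_strands_cat vn.
Qed.

End Trace.

(* Morton--Franks--Williams: [x] is [A^-n] times a polynomial of degree at most
   [n] in [A^2]; moreover [q -> q^-1] multiplies its coefficients by [(-1)^e]. *)
Definition mfw n (e : bool) (x : QqA) : Prop :=
  exists p : {poly Qq}, [/\ (size p <= n.+1)%N,
    forall k, invert_q p`_k = (-1) ^+ e * p`_k
    & x = A ^- n * (map_poly inA p).[A ^+ 2]].

Lemma mfwD n e x y : mfw n e x -> mfw n e y -> mfw n e (x + y).
Proof.
move=> [p [sp tp ->]] [r [sr tr ->]]; exists (p + r); split.
- by rewrite (leq_trans (size_polyD _ _)) // geq_max sp.
- by move=> k; rewrite coefD rmorphD /= tp tr mulrDr.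
- by rewrite rmorphD hornerD mulrDr.
Qed.

Lemma mfw_scale n e (f : bool) c x : invert_q c = (-1) ^+ f * c -> mfw n e x ->
  mfw n (f (+) e) (inA c * x).
Proof.
move=> tc [p [sp tp ->]]; exists (c *: p); split.
- by rewrite (leq_trans (size_scale_leq _ _)).
- by move=> k; rewrite coefZ rmorphM /= tp tc signr_addb mulrACA.
- by rewrite map_polyZ hornerZ mulrCA.
Qed.

Lemma mfwN n e x : mfw n e x -> mfw n e (- x).
Proof.
move=> h; have -> : - x = inA (-1) * x by rewrite [inA _]rmorphN1 mulN1r.
by rewrite -[e]addFb; apply: mfw_scale h; rewrite rmorphN1 mul1r.
Qed.

Lemma graded_mfw n f : graded (fun e => mfw n (f (+) e)).
Proof.
split=> e x; [move=> y; exact: mfwD|exact: mfwN|move=> h].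
rewrite addbN -addTb; apply: mfw_scale => //.
by rewrite invert_qz mulN1r.
Qed.

Lemma mfwA n e x : mfw n e x -> mfw n.+1 e (A * x) /\ mfw n.+1 e (A^-1 * x).
Proof.
move=> [p [sp tp ->]]; split; last first.
  exists p; split=> //; first exact: leqW.
  by rewrite mulrA [A ^+ n.+1]exprS invfM.
exists ('X * p); split.
- have [->|p0] := eqVneq p 0; first by rewrite mulr0 size_poly0.
  by rewrite mulrC size_mulX.
- by case=> [|k]; rewrite coefXM /= ?rmorph0 ?mulr0 // tp.
- rewrite rmorphM /= map_polyX hornerM hornerX !mulrA; congr (_ * _).
  by rewrite exprS invfM [A^-1 * _]mulrC divfK ?A_neq0 // mulrC.
Qed.

(** Induction on the number of strands: each new strand contributes a factor [A] or
    [(A - A^-1) / z], hence one more degree. The sign exponent is the parity of the number of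
    components less one. *)
Lemma mfw_trace H n w : is_HOMFLYPT H -> on_strands n.+1 w ->
  mfw n (odd n (+) odd (size w)) (trace_poly H n.+1 w).
Proof.
move=> hH; elim: n w => [|n IH] w wn.
  (* On one strand the word is empty and its closure is the unknot. *)
  case: w wn => //= _; exists 1; split; first by rewrite size_poly1.
    by move=> k; rewrite coef1 mul1r rmorph_nat.
  rewrite rmorph1 hornerC expr0 invr1 mul1r /trace_poly [writhe _]big_nil mul1r.
  exact: HOMFLYPT_unknot.
apply: (reduces_normal wn (graded_mfw n.+1 (odd n.+1)) (hecke_trace hH n.+2)).
move=> s [sn|[a [b [an bn ->]]]]; last first.
  rewrite trace_normal // size_cat /= addnS addNb addbN negbK addnC -size_cat.
  by apply: (proj1 (mfwA _)); apply: IH; rewrite on_strands_cat bn.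
(* A new strand without a new crossing flips the sign exponent, and so does the odd factor
   [zA^-1]. *)
rewrite trace_split // mulrBl /= addNb -addTb.
have [h1 h2] := mfwA (IH _ sn); rewrite /zA -fmorphV.
apply: mfw_scale; first by rewrite fmorphV /= invert_qz invrN mulN1r.
exact: mfwD (mfwN _).
Qed.

(** * Interpolation at powers of q *)

Section QNumbers.
Variables (F : fieldType) (x : F).
Hypothesis x_neq0 : x != 0.
Hypothesis x_free : forall n, (0 < n)%N -> x ^+ n != 1.

(** The q-numbers are taken at an element [x] of any field, assumed not to be a root of unity; at
    [x = q] they are convertible to those of the statement. *)
Definition qint n : F := (x ^+ n - x ^- n) / (x - x^-1).
Definition qplus n : F := x ^+ n + x ^- n.
Definition qfactorial n : F := \prod_(1 <= i < n.+1) qint i.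
Definition qrising j k : F := \prod_(i < k) qint (j + i).
Definition qcoef b j : F :=
  qint (2 * j + b) * qint b./2 * qrising j.+1 b.-1 / (qfactorial b * qint (j + b./2)).

Lemma sub_xV_neq0 n : (0 < n)%N -> x ^+ n - x ^- n != 0.
Proof.
move=> n0; have := @x_free (n + n) _; rewrite addn_gt0 n0 => /(_ isT).
apply: contra_neq => /eqP; rewrite subr_eq0 => /eqP E.
by rewrite exprD {1}E mulVf // expf_neq0.
Qed.

Lemma x_sub_neq0 : x - x^-1 != 0.
Proof. by have := @sub_xV_neq0 1 isT; rewrite expr1. Qed.

Lemma qint_neq0 n : (0 < n)%N -> qint n != 0.
Proof. by move=> n0; rewrite mulf_neq0 ?sub_xV_neq0 // invr_eq0 x_sub_neq0. Qed.

Lemma qint_double n : qint (2 * n) = qint n * qplus n.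
Proof.
rewrite /qint /qplus mulrAC; congr (_ / _).
by rewrite mul2n -addnn exprD invfM; ring.
Qed.

Lemma qplus_neq0 n : (0 < n)%N -> qplus n != 0.
Proof.
move=> n0; have : qint (2 * n) != 0 by rewrite qint_neq0 // muln_gt0.
by rewrite qint_double mulf_eq0 negb_or => /andP[].
Qed.

Lemma qfactorialS n : qfactorial n.+1 = qfactorial n * qint n.+1.
Proof. by rewrite /qfactorial big_nat_recr. Qed.

Lemma qfactorial_neq0 n : qfactorial n != 0.
Proof.
elim: n => [|n IH]; first by rewrite /qfactorial big_nil oner_neq0.
by rewrite qfactorialS mulf_neq0 ?qint_neq0.
Qed.

(** The quotient [[2j + 2h] / [j + h]] is [qplus (j + h)]; afterwards no denominator depends on
    [j]. *)
Lemma qcoefE h j : (0 < h)%N ->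
  qcoef (2 * h) j = qplus (j + h) * qint h * qrising j.+1 (2 * h).-1 / qfactorial (2 * h).
Proof.
move=> h0; rewrite /qcoef -mulnDr qint_double mul2n doubleK.
have q0 : qint (j + h) != 0 by rewrite qint_neq0 // addn_gt0 h0 orbT.
by have f0 := qfactorial_neq0 h.*2; field; rewrite f0 q0.
Qed.

(** The recursion [qcoef_rec] stripped of its common factors, with [u = x^j] and [v = x^h] made
    independent, so that it is an identity of rational functions. *)
Lemma three_term (u v : F) : u != 0 -> v != 0 ->
  let c := v ^+ 2 * x ^+ 2 in
  (u * v ^+ 2 - (u * v ^+ 2)^-1) * (u * v ^+ 2 * x - (u * v ^+ 2 * x)^-1) *
    (u * v * x + (u * v * x)^-1)
  - (c + c^-1) * ((u - u^-1) * (u * v ^+ 2 - (u * v ^+ 2)^-1) * (u * v + (u * v)^-1))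
  + (u / x - x / u) * (u - u^-1) * (u * v / x + (u * v / x)^-1)
  = (u * v + (u * v)^-1) * (v - v^-1) * (v ^+ 2 * x - (v ^+ 2 * x)^-1) * (v * x + (v *
    x)^-1).
Proof. by move=> u0 v0 c; rewrite /c; field; rewrite u0 v0 x_neq0. Qed.


Lemma qrisingSr j k : qrising j k.+1 = qrising j k * qint (j + k).
Proof. by rewrite /qrising big_ord_recr. Qed.

Lemma qrisingSl j k : qrising j k.+1 = qint j * qrising j.+1 k.
Proof.
rewrite /qrising big_ord_recl addn0; congr (_ * _); apply: eq_bigr => i _.
by rewrite /= /bump addnA addn1.
Qed.

(** In terms of generating series: multiplication by [(X - c)(X - c^-1)] leads from [h + 1] to [h],
    coefficients of negative index being 0. *)
Lemma qcoef_rec h j : (0 < h)%N ->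
  let c := x ^+ (2 * h.+1) in let f := qcoef (2 * h.+1) in
  f j - (c + c^-1) * (if j is i.+1 then f i else 0)
    + (if j is i.+2 then f i else 0) = qcoef (2 * h) j.
Proof.
move=> h0 c f; set R := qrising j.+1 (2 * h).-1.
set f0 := qfactorial (2 * h); set z := x - x^-1.
have z0 : z != 0 := x_sub_neq0.
pose D n := x ^+ n - x ^- n.
have Dq n : qint n = D n / z by [].
have n2h : (2 * h.+1).-1 = (2 * h).-1.+2 by lia.
have n2h1 : (2 * h.+1 = (2 * h).+2)%N by lia.
have fE i : f i = qplus (i + h.+1) * qrising i.+1 (2 * h).-1.+2
     / (f0 * (D (2 * h).+1 / z) * qplus h.+1).
  rewrite /f qcoefE // n2h n2h1 !qfactorialS -n2h1 qint_double -/f0 -Dq.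
  have f00 : f0 != 0 by exact: qfactorial_neq0.
  have q1 : qint h.+1 != 0 by exact: qint_neq0.
  have q2 : qint (2 * h).+1 != 0 by exact: qint_neq0.
  have q3 : qplus h.+1 != 0 by exact: qplus_neq0.
  by field; rewrite f00 q1 q2 q3.
pose u := x ^+ j; pose v := x ^+ h.
have u0 : u != 0 by exact: expf_neq0.
have v0 : v != 0 by exact: expf_neq0.
(* [K] collects the q-numbers and denominators that the three coefficients share. *)
pose K := R / (f0 * (D (2 * h).+1 / z) * qplus h.+1 * z ^+ 2).
have D0 : D 0%N = 0 by rewrite /D expr0 invr1 subrr.
have Ej : f j = K * (D (j + 2 * h)%N * D (j + (2 * h).+1)%N * qplus (j + h.+1)).
  rewrite fE !qrisingSr -/R !Dq /K.
  have -> : (j.+1 + (2 * h).-1 = j + 2 * h)%N by lia.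
  have -> : (j.+1 + (2 * h).-1.+1 = j + (2 * h).+1)%N by lia.
  by rewrite ![R * _]mulrA expr2 !invfM; ring.
(* The defaults 0 fit the general formulas: [D j] vanishes at [j = 0] and, in [E2], [u / x - x / u]
   vanishes at [j = 1]. *)
have E1 : (if j is i.+1 then f i else 0) = K * (D j * D (j + 2 * h)%N * qplus (j + h)).
  clear Ej u0; case: j @u @R @K => [|i] u R K; first by rewrite D0 !mul0r mulr0.
  rewrite fE qrisingSl qrisingSr -/R !Dq /K.
  have -> : (i.+2 + (2 * h).-1 = i.+1 + 2 * h)%N by lia.
  by rewrite addnS -addSn expr2 !invfM; ring.
have E2 : (if j is i.+2 then f i else 0) =
    K * ((u / x - x / u) * D j * (u * v / x + (u * v / x)^-1)).
  clear Ej E1 u0; case: j @u @R @K => [|[|i]] u R K; rewrite /u {u}.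
  - by rewrite D0 mulr0 mul0r mulr0.
  - by rewrite expr1 divff // subrr !mul0r mulr0.
  rewrite fE !qrisingSl -/R !Dq /K.
  have -> : x ^+ i.+2 / x - x / x ^+ i.+2 = D i.+1.
    by rewrite /D exprSr mulfK // invfM mulrCA divff // mulr1.
  have -> : x ^+ i.+2 * v / x = x ^+ (i + h.+1).
    by rewrite addnS -addSn exprD -mulrA [v / x]mulrC mulrA exprSr mulfK.
  rewrite -/(qplus (i + h.+1)) expr2 !invfM; ring.
rewrite Ej E1 E2 /K qcoefE //.
have := three_term u0 v0 => /=.
have -> : v ^+ 2 * x ^+ 2 = c by rewrite /c n2h1 -exprMn -exprSr -exprM mulnC n2h1.
have Dxp n : x ^+ n - (x ^+ n)^-1 = D n by [].
have Sxp n : x ^+ n + (x ^+ n)^-1 = qplus n by [].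
have -> : u * v ^+ 2 = x ^+ (j + 2 * h) by rewrite exprD [(2 * h)%N]mulnC exprM.
have -> : x ^+ (j + 2 * h) * x = x ^+ (j + (2 * h).+1) by rewrite addnS exprSr.
have -> : u * v * x = x ^+ (j + h.+1) by rewrite addnS exprSr exprD.
have -> : u * v = x ^+ (j + h) by rewrite exprD.
have -> : v ^+ 2 * x = x ^+ (2 * h).+1 by rewrite [x ^+ (2 * h).+1]exprSr [(2 *
  h)%N]mulnC exprM.
have -> : v * x = x ^+ h.+1 by rewrite exprSr.
rewrite !Dxp !Sxp => T.
rewrite [qplus (2 * h.+1) * (_ * _)]mulrCA -mulrBr -mulrDr T Dq -/R -/f0.
have f00 : f0 != 0 by exact: qfactorial_neq0.
have d0 : D (2 * h).+1 != 0 by exact: sub_xV_neq0.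
have s0 : qplus h.+1 != 0 by exact: qplus_neq0.
by field; rewrite f00 d0 s0 z0.
Qed.

Lemma qcoef2E j : qcoef 2 j = qint (2 * j.+1) / qint 2.
Proof.
have q1 : qint 1 = 1 by rewrite /qint expr1 divff // x_sub_neq0.
rewrite (@qcoefE 1) // qint_double /qrising big_ord_recl big_ord0 !qfactorialS.
by rewrite /qfactorial big_geq //= q1 addn1 addn0 !(mulr1, mul1r) [qplus _ * _]mulrC.
Qed.

(** The start of the recursion: the coefficients [[2j + 2] / [2]] are those of the series
    [1 / ((X - c)(X - c^-1))]. *)
Lemma qcoef_rec0 j :
  let c := x ^+ 2 in let f := qcoef 2 in
  f j - (c + c^-1) * (if j is i.+1 then f i else 0)
    + (if j is i.+2 then f i else 0) = (j == 0)%:R.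
Proof.
move=> c f; have z0 := x_sub_neq0.
have q2 : qint 2 != 0 by exact: qint_neq0.
have c0 : c != 0 by exact: expf_neq0.
have E i : f i = (c ^+ i.+1 - c ^- i.+1) / (x - x^-1) / qint 2.
  by rewrite /f qcoef2E [qint _]/(_ / _) exprM.
move: (x - x^-1) z0 E => z z0 E.
case: j => [|[|i]]; rewrite /= ?mulr0 ?subr0 ?addr0.
- by rewrite /f qcoef2E divff.
- by rewrite !E !exprS expr0; field; rewrite ?q2 ?c0 ?z0.
rewrite !E !exprS; have ci : c ^+ i != 0 by exact: expf_neq0.
by field; rewrite ?q2 ?c0 ?ci ?z0.
Qed.

(** * The node polynomial and its inverse power series *)

Definition node_poly h : {poly F} :=
  \prod_(k < h) (('X - (x ^+ (2 * k.+1))%:P) * ('X - (x ^- (2 * k.+1))%:P)).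

(** For [h > 0] these are the first [T] terms of the power series [1 / node_poly h]. *)
Definition qseries h T : {poly F} := \poly_(j < T) qcoef (2 * h) j.

Lemma coef_quadM (c : F) (p : {poly F}) j : c != 0 ->
  (('X - c%:P) * ('X - c^-1%:P) * p)`_j =
  p`_j - (c + c^-1) * (if j is i.+1 then p`_i else 0) + (if j is i.+2 then p`_i else 0).
Proof.
move=> c0; have -> : ('X - c%:P) * ('X - c^-1%:P) * p = p - (c + c^-1)%:P * ('X * p) + 'X
  * ('X * p).
  have cc : c%:P * c^-1%:P = 1 :> {poly F} by rewrite -polyCM divff.
  rewrite polyCD -[X in _ = X - _ + _]mul1r -cc; ring.
by rewrite coefD coefB coefCM !coefXM; case: j => [|[|j]].
Qed.

Lemma coefM_low (p f g : {poly F}) T : (forall j, (j < T)%N -> f`_j = g`_j) ->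
  forall j, (j < T)%N -> (p * f)`_j = (p * g)`_j.
Proof.
move=> fg j lt_j; rewrite !coefM; apply: eq_bigr => i _; rewrite fg //.
exact: leq_ltn_trans (leq_subr _ _) lt_j.
Qed.

Lemma node_poly_qseries h T j : (0 < h)%N -> (j < T)%N ->
  (node_poly h * qseries h T)`_j = (j == 0)%:R.
Proof.
move=> h0 lt_j; have x2 n : x ^+ n != 0 by exact: expf_neq0.
elim: h h0 j lt_j => // h IH _ j lt_j.
have low k : (k < T)%N -> (qseries h.+1 T)`_k = qcoef (2 * h.+1) k.
  by move=> lt_k; rewrite coef_poly lt_k.
(* At [h = 0] the series left is 1, whereas [qseries x 0 T] is zero because of the factor [[0]]. *)
have rec k : (k < T)%N ->
    (('X - (x ^+ (2 * h.+1))%:P) * ('X - (x ^- (2 * h.+1))%:P) * qseries h.+1 T)`_k =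
    if h is 0%N then (k == 0)%:R else (qseries h T)`_k.
  move=> lt_k; rewrite coef_quadM // low //.
  have -> : (if k is i.+1 then (qseries h.+1 T)`_i else 0) =
            (if k is i.+1 then qcoef (2 * h.+1) i else 0).
    by case: k lt_k => // k lt_k; rewrite low // ltnW.
  have -> : (if k is i.+2 then (qseries h.+1 T)`_i else 0) =
            (if k is i.+2 then qcoef (2 * h.+1) i else 0).
    by case: k lt_k => [|[|k]] // lt_k; rewrite low //; exact: ltnW (ltnW lt_k).
  case: h {IH low} => [|h]; first exact: qcoef_rec0.
  by rewrite coef_poly lt_k; apply: qcoef_rec.
rewrite /node_poly big_ord_recr -mulrA; case: h IH low rec => [|h] IH low rec.
  by rewrite big_ord0 mul1r rec.
by rewrite (coefM_low _ rec) // IH.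
Qed.

End QNumbers.

Lemma horner_map_poly_def (F L : fieldType) (phi : {rmorphism F -> L}) E T (y : L) :
  (map_poly phi (\poly_(j < T) E j)).[y] = \sum_(0 <= j < T) phi (E j) * y ^+ j.
Proof.
rewrite big_mkord poly_def rmorph_sum horner_sum; apply: eq_bigr => j _.
by rewrite /= map_polyZ map_polyXn hornerZ hornerXn.
Qed.

Section Interpolation.
Variables (F : fieldType) (x : F).
Hypothesis x_neq0 : x != 0.
Hypothesis x_free : forall n, (0 < n)%N -> x ^+ n != 1.

Lemma expf_free_inj : injective (fun n => x ^+ n).
Proof.
move=> m n; wlog lt_mn : m n / (m < n)%N.
  by case: (ltngtP m n) => // h W; [apply: W|move=> E; symmetry; apply: W].
move=> E; have : x ^+ (n - m) != 1 by rewrite x_free // subn_gt0.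
have mn := subnKC (ltnW lt_mn); move: E; rewrite /= -{1}mn exprD.
by move=> /esym/eqP; rewrite -subr_eq0 -{2}[x ^+ m]mulr1 -mulrBr mulf_eq0 expf_eq0 (negPf
  x_neq0) andbF subr_eq0 /= => ->.
Qed.

Definition nodes h : seq F :=
  [seq x ^+ (2 * k.+1) | k <- iota 0 h] ++ [seq x ^- (2 * k.+1) | k <- iota 0 h].

Lemma size_nodes h : size (nodes h) = (2 * h)%N.
Proof. by rewrite size_cat !size_map size_iota addnn mul2n. Qed.

Lemma nodes_uniq h : uniq (nodes h).
Proof.
have inj : injective (fun k => x ^+ (2 * k.+1)).
  by move=> m n /expf_free_inj /eqP; rewrite eqn_mul2l => /eqP[].
have injV : injective (fun k => x ^- (2 * k.+1)) by move=> m n /invr_inj /inj.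
rewrite cat_uniq !map_inj_uniq ?iota_uniq //= andbT.
apply/hasPn => _ /mapP[m _ ->]; apply/mapP => -[n _ E].
have /eqP[] := @x_free (2 * m.+1 + 2 * n.+1) isT.
by rewrite exprD -E divff // expf_neq0.
Qed.

Lemma node_polyE h : node_poly x h = \prod_(r <- nodes h) ('X - r%:P).
Proof.
rewrite big_cat !big_map /= -big_split /= /node_poly.
by rewrite -(big_mkord xpredT (fun k => ('X - (x ^+ (2 * k.+1))%:P) * ('X - (x ^- (2 *
  k.+1))%:P))) /index_iota subn0.
Qed.

Lemma nodesV h r : r \in nodes h -> r^-1 \in nodes h.
Proof.
rewrite !mem_cat => /orP[]/mapP[k lt_k ->]; apply/orP; [right|left].
  by apply/mapP; exists k.
by apply/mapP; exists k; rewrite ?invrK.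
Qed.

Lemma nodes_neq0 h r : r \in nodes h -> r != 0.
Proof. by rewrite mem_cat => /orP[]/mapP[k _ ->]; rewrite ?invr_eq0 expf_neq0. Qed.

Lemma coef0_node_poly h : (node_poly x h)`_0 = 1.
Proof.
rewrite -horner_coef0 /node_poly horner_prod big1 // => k _.
by rewrite hornerM !hornerXsubC !sub0r mulrNN divff // expf_neq0.
Qed.

(** The left-hand side vanishes at the [2h] nodes, so [P] divides it. The quotient has degree less
    than [T] and equals [-1 / P] modulo [X^T], which determines it. *)
Lemma interpolate h T (p : {poly F}) : (0 < h)%N -> (0 < T)%N -> (size p <= 2 * h)%N ->
  (forall r, r \in nodes h -> r ^+ T * p.[r] = 1) ->
  'X^T * p - 1 = - qseries x h T * node_poly x h.
Proof.
move=> h0 T0 sp pr; set g := 'X^T * p - 1; set S := qseries x h T; set P := node_poly x h.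
have rg : all (root g) (nodes h).
  by apply/allP => r /pr E;
    rewrite /root /g hornerD hornerM hornerXn hornerN hornerC E subrr.
have [f Ef] : exists f, g = f * P.
  by rewrite /P node_polyE; apply: uniq_roots_prod_XsubC => //;
    rewrite uniq_rootsE nodes_uniq.
have sP : size P = (2 * h).+1 by rewrite /P node_polyE size_prod_XsubC size_nodes.
have mP : P \is monic by rewrite /P node_polyE monic_prod_XsubC.
have sf : (size f <= T)%N.
  have [->|f0] := eqVneq f 0; first by rewrite size_poly0.
  have : (size g <= T + 2 * h)%N.
    rewrite (leq_trans (size_polyD _ _)) // geq_max size_polyN size_poly1.
    rewrite (leq_trans (size_polyMleq _ _)) ?size_polyXn ?addSn ?leq_add2l //=.
    by rewrite (leq_trans T0) // leq_addr.
  by rewrite Ef size_Mmonic // sP addnS /= leq_add2r.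
suff fS : f = - S by rewrite Ef fS.
apply/eqP; rewrite -subr_eq0 opprK; apply/eqP/polyP => j; rewrite coef0.
(* Below degree [T], the product [f * P] agrees with -1 and [S * P] with 1. *)
have low i : (i < T)%N -> ((f + S) * P)`_i = 0.
  move=> lt_i; rewrite mulrDl -Ef coefD [S * P]mulrC node_poly_qseries //.
  by rewrite coefB coefXnM lt_i coef1 sub0r addNr.
have [le_j|lt_j] := leqP T j.
  by rewrite nth_default // (leq_trans _ le_j) // (leq_trans (size_polyD _ _)) // geq_max
    sf size_poly.
(* As [P] has constant term 1, the coefficients of [f + S] vanish one after the other. *)
elim/ltn_ind: j lt_j => j IH lt_j; have := low j lt_j.
rewrite coefM big_ord_recr /= subnn coef0_node_poly mulr1 big1 ?add0r // => i _.
by rewrite IH ?mul0r // (ltn_trans (ltn_ord i)).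
Qed.

Lemma horner_node_poly (L : fieldType) (phi : {rmorphism F -> L}) h (y : L) :
  (map_poly phi (node_poly x h)).[y] =
  \prod_(k < h) ((y - phi (x ^+ (2 * k.+1))) * (y - phi (x ^- (2 * k.+1)))).
Proof.
rewrite [map_poly _ _]rmorph_prod horner_prod; apply: eq_bigr => k _.
by rewrite rmorphM !rmorphB /= !map_polyX !map_polyC hornerM !hornerXsubC.
Qed.

(** The nodes come in inverse pairs, which makes the node polynomial self-reciprocal. *)
Lemma horner_node_polyV (L : fieldType) (phi : {rmorphism F -> L}) h (y : L) : y != 0 ->
  (map_poly phi (node_poly x h)).[y^-1] = y ^- (2 * h) * (map_poly phi (node_poly x h)).[y].
Proof.
move=> y0; rewrite !horner_node_poly.
elim: h => [|h IH]; first by rewrite !big_ord0 mulr1 invr1.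
rewrite !big_ord_recr /= IH fmorphV; set c := phi _.
have c0 : c != 0 by rewrite fmorph_eq0 expf_neq0.
have -> : (2 * h.+1 = (2 * h).+2)%N by lia.
rewrite !exprS; have yh : y ^+ (2 * h) != 0 by exact: expf_neq0.
by field; rewrite y0 c0 yh.
Qed.

(** The exponents of [X^t p] lie in a window of [2h] consecutive integers; the cases are whether
    this window lies above 0, contains 0, or lies below 0. *)
Lemma interpolation_trichotomy (L : fieldType) (phi : {rmorphism F -> L}) (y : L)
    h (p : {poly F}) (t : int) :
  y != 0 -> (0 < h)%N -> (size p <= 2 * h)%N ->
  (forall r, r \in nodes h -> r ^ t * p.[r] = 1) ->
  let ev (g : {poly F}) z := (map_poly phi g).[z] in
  let f := y ^ t * ev p y in
  f = 1 \/ exists m,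
    f = 1 - y ^- (2 * h) * ev (qseries x h m.+1) y^-1 * ev (node_poly x h) y \/
    f = 1 - ev (qseries x h m.+1) y * ev (node_poly x h) y.
Proof.
move=> y0 h0 sp pv ev f.
have evB g g' z : ev (g - g') z = ev g z - ev g' z by rewrite /ev rmorphB hornerD hornerN.
have evM g g' z : ev (g * g') z = ev g z * ev g' z by rewrite /ev rmorphM hornerM.
have evN g z : ev (- g) z = - ev g z by rewrite /ev rmorphN hornerN.
have evX n z : ev 'X^n z = z ^+ n by rewrite /ev map_polyXn hornerXn.
have ev1 z : ev 1 z = 1 by rewrite /ev rmorph1 hornerC.
case: (ltrP 0 t) => [t0|t0].
  have [T ET] : exists T : nat, t = T.+1%:Z by exists `|t|%N.-1; lia.
  subst t; right; exists T; right.
  have := interpolate h0 (ltn0Sn T) sp pv.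
  move/(congr1 (fun g => ev g y)); rewrite evB !evM evN ev1 evX mulNr => E.
  by rewrite -E addrC subrK.
have [s Es] : exists s : nat, t = - s%:Z by exists `|t|%N; lia.
subst t; have [le_s|lt_s] := leqP (2 * h) s; last first.
  (* Both polynomials have degree less than [2h], and they agree at the [2h] nodes. *)
  left; suff Ep : p = 'X^s by rewrite /f Ep evX -exprnN mulVf // expf_neq0.
  apply/eqP; rewrite -subr_eq0; apply/eqP; apply: (@roots_geq_poly_eq0 _ _ (nodes h)).
  - apply/allP => r nr; have r0 := nodes_neq0 nr; rewrite /root hornerD hornerN hornerXn.
    by rewrite subr_eq0; apply/eqP/(mulfI (invr_neq0 (expf_neq0 s r0)));
      rewrite exprnN pv // -exprnN mulVf // expf_neq0.
  - exact: nodes_uniq.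
  - rewrite size_nodes (leq_trans (size_polyD _ _)) // geq_max sp size_polyN size_polyXn.
    exact: lt_s.
right; exists (s - 2 * h)%N; left; set T := (s - 2 * h).+1.
(* Reversing [p] turns negative powers of [y] into positive powers of [y^-1], with lowest exponent
   [T = s - 2h + 1]; this reduces to the first case. *)
pose p' := \poly_(i < 2 * h) p`_((2 * h).-1 - i).
(* Stated for any field morphism: the identity serves at the nodes, and [phi] serves at [y^-1]. *)
have rev (K : fieldType) (psi : {rmorphism F -> K}) (z : K) : z != 0 ->
    (map_poly psi p').[z] = z ^+ (2 * h).-1 * (map_poly psi p).[z^-1].
  move=> z0; rewrite horner_map_poly_def big_mkord.
  rewrite (horner_coef_wide _ (n := 2 * h)); last by rewrite size_map_poly.
  rewrite mulr_sumr (reindex_inj rev_ord_inj) /=; apply: eq_bigr => i _.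
  have lt_i := ltn_ord i; rewrite coef_map /=.
  have -> : ((2 * h).-1 - (2 * h - i.+1) = i)%N by lia.
  rewrite mulrCA; congr (_ * _); have -> : ((2 * h).-1 = (2 * h - i.+1) + i)%N by lia.
  by rewrite exprD exprVn mulfK // expf_neq0.
have p'v r : r \in nodes h -> r ^+ T * p'.[r] = 1.
  move=> nr; have r0 := nodes_neq0 nr.
  have := rev F idfun r r0; rewrite !map_poly_id // => ->.
  rewrite mulrA -exprD; have -> : (T + (2 * h).-1 = s)%N by rewrite /T; lia.
  by have := pv _ (nodesV nr); rewrite -exprnN exprVn invrK.
have := interpolate h0 (ltn0Sn _) (size_poly _ _) p'v.
move/(congr1 (fun g => ev g y^-1)); rewrite evB !evM evN ev1 evX mulNr.
rewrite [ev p' _]rev ?invr_neq0 // invrK {2}/ev horner_node_polyV // mulrA -exprD.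
have -> : (T + (2 * h).-1 = s)%N by rewrite /T; lia.
rewrite exprVn exprnN -/(ev p y) -/f => E.
by rewrite -mulrA mulrCA -E addrC subrK.
Qed.

End Interpolation.

(** * The theorem *)

Lemma prod_symmetric (R : comNzRingType) (f : int -> R) h :
  \prod_(i < (2 * h).+1 | i != h :> nat) f (i%:Z - h%:Z) =
  \prod_(k < h) (f k.+1%:Z * f (- k.+1%:Z)).
Proof.
elim: h => [|h IH].
  rewrite big_ord0 big_mkcond big_ord_recl big_ord0 /= mulr1 //.
have -> : (2 * h.+1 = (2 * h).+2)%N by lia.
rewrite [LHS]big_mkcond [LHS]big_ord_recl /= [X in _ * X]big_ord_recr [RHS]big_ord_recr
  /= -IH [in RHS]big_mkcond /=.
rewrite sub0r [f (- _) * _]mulrC -mulrA; congr (_ * _).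
  apply: eq_bigr => i _; rewrite /bump /= add1n eqSS; case: ifP => // _.
  by congr f; rewrite -[i.+1]addn1 -[h.+1]addn1 !PoszD; ring.
rewrite /bump /= add1n eqSS ifT; last by lia.
by congr (f _ * _); lia.
Qed.

Lemma prodA_node h : prodA (2 * h) = (map_poly inA (node_poly q h)).[A ^+ 2].
Proof.
rewrite /prodA mul2n doubleK -mul2n.
rewrite (prod_symmetric (fun k => A ^+ 2 - inA (q ^ (2 * k)))).
rewrite horner_node_poly; apply: eq_bigr => k _.
have -> : 2 * - k.+1%:Z = - (2 * k.+1)%N%:Z :> int by lia.
by rewrite -exprnN.
Qed.

Lemma coefFE b j : coefF b j = qcoef q b j.
Proof. by []. Qed.

Lemma F_posE h m : F_pos (2 * h) m = - (map_poly inA (qseries q h m.+1)).[A ^+ 2].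
Proof.
rewrite horner_map_poly_def /F_pos; congr (- _); apply: eq_bigr => j _.
by rewrite coefFE exprM.
Qed.

Lemma F_negE h m : F_neg (2 * h) m =
  - (A ^- (2 * (2 * h)) * (map_poly inA (qseries q h m.+1)).[A ^- 2]).
Proof.
rewrite horner_map_poly_def /F_neg mulr_sumr; congr (- _); apply: eq_bigr => j _.
by rewrite coefFE mulrCA exprVn -exprM -invfM -exprD addnC.
Qed.

Lemma tofrac_comp_X2 (p : {poly Qq}) : (map_poly inA p).[A ^+ 2] = tofrac (p \Po 'X^2).
Proof.
elim/poly_ind: p => [|p c IH]; first by rewrite comp_poly0 tofrac0 map_poly0 horner0.
rewrite [map_poly _ (_ + _)]rmorphD rmorphM /= map_polyX map_polyC hornerMXaddC IH.
by rewrite comp_polyD comp_polyM comp_polyX comp_polyC tofracD tofracM tofracXn.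
Qed.

(** The value is independent of the fraction chosen: clearing denominators, including a negative
    power of ['X], leaves an identity of polynomials, which can be evaluated at [a]. *)
Lemma laurent_eval (F L : fieldType) (phi : {rmorphism {poly F} -> L}) (a : F)
    (P D G : {poly F}) (t : int) :
  injective phi -> a != 0 -> D.[a] != 0 ->
  phi 'X ^ t * phi G = phi P / phi D -> P.[a] / D.[a] = a ^ t * G.[a].
Proof.
move=> inj a0 Da E; have phi0 x : x != 0 -> phi x != 0.
  by apply: contra_neq => xz; apply: inj; rewrite xz rmorph0.
have D0 : phi D != 0 by apply: phi0; apply: contraNneq Da => ->; rewrite horner0.
have X0 : phi 'X != 0 by apply: phi0; rewrite polyX_eq0.
have {}E : phi P = phi 'X ^ t * phi G * phi D by rewrite E divfK.
apply: (mulIf Da); rewrite divfK //; case: t E => n; rewrite ?NegzE -?exprnN -?exprnP => E.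
  move: E; rewrite -rmorphXn -!rmorphM => /inj ->.
  by rewrite !hornerM hornerXn.
have : phi ('X^(n.+1) * P) = phi (G * D).
  by rewrite !rmorphM E rmorphXn -mulrA mulVKf // expf_neq0.
move=> /inj /(congr1 (fun p => p.[a])).
rewrite /= !hornerM hornerXn => {}E; have an : a ^+ n.+1 != 0 by rewrite expf_neq0.
by apply: (mulfI an); rewrite E -mulrA mulVKf.
Qed.

Lemma has_value_laurent (p : {poly Qq}) (t : int) a v : a != 0 ->
  has_value_at (A ^ (2 * t) * (map_poly inA p).[A ^+ 2]) a v ->
  (a ^+ 2) ^ t * p.[a ^+ 2] = v.
Proof.
move=> a0 [P [D [Da E ->]]]; rewrite tofrac_comp_X2 in E.
have inj : injective (@tofrac {poly Qq}) by move=> x y /eqP; rewrite tofrac_eq => /eqP.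
by rewrite (laurent_eval inj a0 Da E) horner_comp hornerXn -exprz_exp.
Qed.

Lemma horner_invert_q (p : {poly Qq}) y : (forall k, invert_q p`_k = p`_k) ->
  invert_q p.[y] = p.[invert_q y].
Proof.
move=> pk; rewrite -horner_map; congr _.[_].
by apply/polyP => k; rewrite coef_map /= pk.
Qed.

(* Sending [q] to [q^-1] turns the vanishing at [A = q^n] into the one at
   [A = q^-n]. *)
Lemma node_values (p : {poly Qq}) (t : int) h : (forall k, invert_q p`_k = p`_k) ->
  (forall n, (1 <= n)%N -> (n <= h)%N ->
     has_value_at (A ^ (2 * t) * (map_poly inA p).[A ^+ 2]) (q ^+ n) 1) ->
  forall r, r \in nodes q h -> r ^ t * p.[r] = 1.
Proof.
move=> pk pv r; have pos k : k \in iota 0 h ->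
    (q ^+ (2 * k.+1)) ^ t * p.[q ^+ (2 * k.+1)] = 1.
  rewrite mem_iota add0n => /= lt_k.
  have := has_value_laurent (expf_neq0 k.+1 q_neq0) (pv k.+1 isT lt_k).
  by rewrite -exprM mulnC.
rewrite mem_cat => /orP[]/mapP[k /pos E ->] //.
move/(congr1 invert_q): E; rewrite rmorphM rmorph1 /= horner_invert_q //.
by rewrite fmorphXz /= rmorphXn /= invert_qq exprVn.
Qed.

Definition braid_word n (beta : braid n) : seq (nat * bool) :=
  [seq (nat_of_ord g.1, g.2) | g <- beta].

Lemma braid_closureE n (beta : braid n) : braid_closure beta = braid_diagram n
  (braid_word beta).
Proof. by rewrite /braid_diagram /crossings -map_comp. Qed.

Lemma braid_word_on_strands n (beta : braid n) : on_strands n (braid_word beta).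
Proof. by apply/allP => _ /mapP[[[i lt_i] e] _ ->] /=; lia. Qed.

(** The braid permutation is a cycle of odd parity, so the number of crossings is odd. Hence the
    symmetry sign is [+], and [- writhe w - m] is even, so that only powers of [A^2] occur. *)
Lemma HOMFLYPT_knot H m K (beta : braid m.+1) : is_HOMFLYPT H -> odd m -> is_knot K ->
  isotopic (braid_closure beta) K ->
  exists (t : int) (p : {poly Qq}), [/\ (size p <= m.+1)%N,
    forall k, invert_q p`_k = p`_k & H K = A ^ (2 * t) * (map_poly inA p).[A ^+ 2]].
Proof.
move=> hH odd_m knotK; rewrite braid_closureE; set w := braid_word beta => wK.
have wn : on_strands m.+1 w := braid_word_on_strands beta.
have odd_w : odd (size w).
  by rewrite (crossing_perm_transitive wn) // (colorings_isotopic wK) knot_colorings.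
have [p [sp tp Ew]] := mfw_trace hH wn.
have [t Et] : exists t : int, - writhe w - m%:Z = 2 * t.
  exists ((- writhe w - m%:Z) %/ 2)%Z; have := odd_writhe w; rewrite odd_w => odd_wr.
  lia.
exists t, p; split=> // [k|]; first by rewrite tp odd_m odd_w mul1r.
rewrite -(HOMFLYPT_isotopy hH wK) -Et (expfzDr _ _ A_neq0) -mulrA -exprnN -Ew /trace_poly.
by rewrite mulrA -(expfzDr _ _ A_neq0) addNr expr0z mul1r.
Qed.

Unset Implicit Arguments.

Theorem theorem3p3 (H : word -> QqA) (H_HOMFLYPT : is_HOMFLYPT H)
    (b : nat) (b_gt0 : (0 < b)%N) (b_even : ~~ odd b)
    (K : word) (K_knot : is_knot K) (K_index : braid_index K b)
    (H_nontrivial : H K <> 1)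
    (sl_trivial : forall n : nat, (1 <= n)%N -> (n <= b./2)%N ->
       has_value_at (H K) (q ^+ n) 1) :
  exists m : nat,
    H K = 1 + F_neg b m * prodA b \/ H K = 1 + F_pos b m * prodA b.
Proof.
have [[beta beta_K] _] := K_index.
case: b b_gt0 b_even beta beta_K sl_trivial {K_index} => // c _ odd_c beta beta_K
  sl_trivial.
have [t [p [sp tp EK]]] := HOMFLYPT_knot H_HOMFLYPT (negbNE odd_c) K_knot beta_K.
have [h Eh] : exists h, c.+1 = (2 * h)%N.
  by exists c.+1./2; rewrite -[LHS]odd_double_half (negPf odd_c) mul2n.
have h0 : (0 < h)%N by lia.
rewrite Eh in sp sl_trivial *; rewrite mul2n doubleK in sl_trivial.
have := @node_values p t h tp; rewrite -EK => /(_ sl_trivial) pv.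
(* The nodes are powers of [q] in [Qq], while the conclusion is read in [QqA] at [y = A^2]. *)
have := interpolation_trichotomy q_neq0 qX_neq1 inA (expf_neq0 2 A_neq0) h0 sp pv.
rewrite -exprz_exp in EK; rewrite /= -EK => -[//|[m Em]].
exists m; rewrite F_posE F_negE prodA_node !mulNr -exprM in Em *.
by case: Em => ->; [left|right].
Qed.
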